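(* Let $r\ge 1$ be a natural number, let $\mathbb{F}_r$ be the free group on the set $\{a_1,\dots,a_r\}$ of free generators, and put $S=\{a_1^{\pm1},\dots,a_r^{\pm1}\}$. Let $\mu$ be a Markov measure on $\partial\mathbb{F}_r$ whose stochastic matrix $P$ is weakly inverse-symmetric and admits a positive stationary distribution. Then the following are equivalent: (1) The boundary action $\mathbb{F}_r\curvearrowright(\partial\mathbb{F}_r,\mu)$ is weakly mixing. (2) The boundary action $\mathbb{F}_r\curvearrowright(\partial\mathbb{F}_r,\mu)$ is boundedly chaining. (3) The boundary action $\mathbb{F}_r\curvearrowright(\partial\mathbb{F}_r,\mu)$ is $(2r-1)$-chaining. (4) $P$ is strictly irreducible.
   Context: $\mathbb{N}$ includes $0$. $\partial\mathbb{F}_r\subseteq S^{\mathbb{N}}$ is the closed set of infinite reduced words ($x_{i+1}\ne x_i^{-1}$ for all $i$); $\mathbb{F}_r$ acts on it by concatenation on the left followed by cancellation (the boundary action). Markov measure: given a row-stochastic matrix $P$ indexed by $S$ and a strictly positive probability distribution $\pi$ on $S$ (not assumed $P$-stationary), the induced Markov measure is the Borel probability measure $\mu$ on $S^{\mathbb{N}}$ with $\mu([w])=\pi(w_0)P(w_0,w_1)\cdots P(w_{n-2},w_{n-1})$ for every $w\in S^n$, $n\ge1$, where $[w]$ is the set of sequences extending $w$. A Markov measure on $\partial\mathbb{F}_r$ is one supported on $\partial\mathbb{F}_r$, i.e. $P(a,a^{-1})=0$ for all $a\in S$. A stationary distribution of $P$ is a probability vector $\pi'$ on $S$ with $\pi'P=\pi'$;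 it is positive if all entries are positive. $P$ is weakly inverse-symmetric if for all $a,b\in S$ with $b\neq a^{\pm1}$: $P(a,b)=0$ iff $P(a^i,b^j)=0$ for all $i,j\in\{1,-1\}$. A nonnegative matrix $Q$ on $S$ is irreducible if for all $a,b\in S$ there is $n\ge1$ with $Q^n(a,b)>0$. $P$ is strictly irreducible if both $P$ and $PP^t$ are irreducible (for irreducible $P$, irreducibility of $PP^t$ is equivalent to that of $P^tP$). The boundary action may be singular (not measure-class preserving) with respect to $\mu$; the following definitions apply to any Borel action of a countable group $\Gamma$ on a standard probability space $(X,\mu)$. Ergodic: every $\Gamma$-invariant $\mu$-measurable set is null or conull. Weakly mixing: for every ergodic probability measure preserving action of $\Gamma$ on a standard probability space $(Y,\nu)$, the diagonal action $\Gamma\curvearrowright(X\times Y,\mu\times\nu)$ is ergodic. $A$ $k$-chains to $B$ if there are $\gamma_0=1_\Gamma,\gamma_1,\dots,\gamma_k\in\Gamma$ with $\mu(\gamma_iA\cap\gamma_{i+1}A)>0$ for $0\le i<k$ and $\mu(\gamma_kA\cap B)>0$. The action is $k$-chaining if $A$ $k$-chains to $B$ for all (Borel) sets $A,B\subseteq X$ of positive measure; it is boundedly chaining if it is $k$-chaining for some $k\in\mathbb{N}$. *)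

(* Defs.v *)
From HB Require Import structures.
From mathcomp Require Import all_boot all_order all_algebra.
From mathcomp Require Import all_classical all_reals all_analysis.
From mathcomp Require Import measurable_realfun.
Set Implicit Arguments.
Unset Strict Implicit.
Unset Printing Implicit Defensive.
Import Order.TTheory GRing.Theory Num.Theory.
Local Open Scope classical_set_scope.
Local Open Scope ring_scope.

(* [(i, false)] is the generator a_i and [(i, true)] is its inverse. *)
Notation letter r := ('I_r * bool)%type.

Definition linv {r} (a : letter r) : letter r := (a.1, ~~ a.2).

Lemma linvK r : involutive (@linv r).
Proof. by case=> i e; rewrite /linv /= negbK. Qed.

(* [lexp a false] is a and [lexp a true] is a^-1. *)
Definition lexp {r} (a : letter r) (e : bool) : letter r :=
  if e then linv a else a.

Definition reduced {r} (w : seq (letter r)) : bool :=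
  sorted (fun a b => b != linv a) w.

Definition push {r} (a : letter r) (w : seq (letter r)) : seq (letter r) :=
  if w is b :: w' then if b == linv a then w' else a :: w else [:: a].

Section FreeGroup.
Variable r : nat.
Implicit Types (a : letter r) (u v w : seq (letter r)).

Lemma reduced_push a w : reduced w -> reduced (push a w).
Proof.
case: w => //= b w; case: ifPn => [_|nb] rw; first exact: path_sorted rw.
by rewrite /= nb.
Qed.

Lemma pushK a w : reduced w -> push a (push (linv a) w) = w.
Proof.
case: w => [_|b w] /=; first by rewrite eqxx.
rewrite linvK; case: eqVneq => [->|nb] rw /=; last by rewrite eqxx.
by case: w rw => //= c w /andP[/negPf ->].
Qed.

Lemma push_reduced a w : reduced (a :: w) -> push a w = a :: w.
Proof. by case: w => //= b w /andP[/negPf ->]. Qed.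

Definition wmul u v := foldr push v u.

Lemma reduced_wmul u v : reduced v -> reduced (wmul u v).
Proof. by move=> rv; elim: u => //= a u; apply: reduced_push. Qed.

Lemma wmul_push a u v : reduced u -> reduced v ->
  wmul (push a u) v = push a (wmul u v).
Proof.
case: u => //= b u ru rv; case: eqVneq => [->|//].
by rewrite pushK// reduced_wmul.
Qed.

Lemma wmulA u v w : reduced v -> reduced w ->
  wmul u (wmul v w) = wmul (wmul u v) w.
Proof.
move=> rv rw; elim: u => //= a u IH.
by rewrite wmul_push ?reduced_wmul// IH.
Qed.

Lemma wmulw0 w : reduced w -> wmul w [::] = w.
Proof.
elim: w => //= a w IH raw; rewrite IH ?push_reduced//.
exact: path_sorted raw.
Qed.

Definition winv w := rev (map linv w).

Lemma reduced_winv w : reduced w -> reduced (winv w).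
Proof.
rewrite /reduced /winv rev_sorted sorted_map; apply: sub_sorted => a b /=.
by rewrite linvK eq_sym.
Qed.

Lemma winvK w : winv (winv w) = w.
Proof. by rewrite /winv map_rev revK mapK//; apply: linvK. Qed.

Lemma wmulVw w : wmul (winv w) w = [::].
Proof.
rewrite /wmul /winv; elim: w => //= a w IH.
by rewrite rev_cons foldr_rcons /= linvK eqxx.
Qed.

Lemma wmulwV w : wmul w (winv w) = [::].
Proof. by rewrite -{1}(winvK w) wmulVw. Qed.

End FreeGroup.

Record free_group (r : nat) := FreeWord {
  fword :> seq (letter r);
  fword_reduced : reduced fword }.

HB.instance Definition _ r := [isSub for @fword r].
HB.instance Definition _ r := [Countable of free_group r by <:].

Section FreeGroupStructure.
Variable r : nat.
Implicit Types g h k : free_group r.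

Definition fone : free_group r := @FreeWord r [::] isT.
Definition fmul g h : free_group r :=
  FreeWord (reduced_wmul g (fword_reduced h)).
Definition finv g : free_group r := FreeWord (reduced_winv (fword_reduced g)).

Fact fmulA : associative fmul.
Proof.
by move=> g h k; apply/val_inj; rewrite /= wmulA// fword_reduced.
Qed.
Fact fmul1g : left_id fone fmul.
Proof. by move=> g; apply/val_inj. Qed.
Fact fmulg1 : right_id fone fmul.
Proof. by move=> g; apply/val_inj; rewrite /= wmulw0// fword_reduced. Qed.
Fact fmulVg : left_inverse fone finv fmul.
Proof. by move=> g; apply/val_inj; rewrite /= wmulVw. Qed.
Fact fmulgV : right_inverse fone finv fmul.
Proof. by move=> g; apply/val_inj; rewrite /= wmulwV. Qed.

HB.instance Definition _ :=
  isGroup.Build (free_group r) fmulA fmul1g fmulg1 fmulVg fmulgV.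

End FreeGroupStructure.

Notation borel_space T := (g_sigma_algebraType (@open T)).

Notation letter_seq r := {ptws nat -> discrete_topology (letter r)}.

Definition reduced_seqs (r : nat) : set (letter_seq r) :=
  [set x | forall i, x i.+1 <> linv (x i)].
Arguments reduced_seqs r : clear implicits.

(* Measurable types are pointed, hence the dependency on [0 < r]. *)
Definition boundary (r : nat) (hr : (0 < r)%N) : Type :=
  set_type (reduced_seqs r).

Section Boundary.
Variables (r : nat) (hr : (0 < r)%N).

HB.instance Definition _ :=
  Topological.copy (boundary hr) (set_type (reduced_seqs r)).

Fact boundary_point_subproof :
  ((fun=> (Ordinal hr, false)) : letter_seq r) \in reduced_seqs r.
Proof. by rewrite inE => i. Qed.

HB.instance Definition _ :=
  isPointed.Build (boundary hr) (SigSub boundary_point_subproof).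

Definition push_seq (a : letter r) (x : letter_seq r) : letter_seq r :=
  if x 0%N == linv a then fun n => x n.+1
  else fun n => if n is m.+1 then x m else a.

Lemma push_seq_reduced a x : reduced_seqs r x -> reduced_seqs r (push_seq a x).
Proof.
rewrite /reduced_seqs /push_seq /= => rx; case: eqP => [_ i|nx [|i]].
- exact: rx.
- exact: nx.
- exact: rx.
Qed.

Fact boundary_action_subproof (g : free_group r) (x : boundary hr) :
  foldr push_seq (set_val x) g \in reduced_seqs r.
Proof.
rewrite inE; elim: (fword g) => [|a w IH]; first exact: set_valP.
exact: push_seq_reduced.
Qed.

Definition boundary_action (g : free_group r) (x : boundary hr) : boundary hr :=
  SigSub (boundary_action_subproof g x).

End Boundary.
Arguments push_seq {r} a x.
Arguments boundary_action {r} hr g x.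

Definition is_action (G : groupType) (X : Type) (act : G -> X -> X) : Prop :=
  (forall x, act 1%g x = x) /\
  (forall g h x, act (g * h)%g x = act g (act h x)).

Definition is_borel_action (G : groupType) d (X : measurableType d)
    (act : G -> X -> X) : Prop :=
  is_action act /\ forall g, measurable_fun setT (act g).

Section BoundaryActionBorel.
Variables (r : nat) (hr : (0 < r)%N).
Implicit Types (a : letter r) (x y : letter_seq r) (g h : free_group r).

Lemma push_seqK a x : reduced_seqs r x -> push_seq a (push_seq (linv a) x) = x.
Proof.
move=> rx; rewrite {2}/push_seq linvK.
case: ifPn => [/eqP x0|_]; last by rewrite /push_seq eqxx.
apply/funext => n; rewrite /push_seq ifF; first by case: n.
by apply/negbTE/eqP; rewrite -x0; exact: rx.
Qed.

Lemma push_seqs_reduced (w : seq (letter r)) x :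
  reduced_seqs r x -> reduced_seqs r (foldr push_seq x w).
Proof. by move=> rx; elim: w => //= a w; exact: push_seq_reduced. Qed.

Lemma push_seq_wmul (u v : seq (letter r)) x : reduced v -> reduced_seqs r x ->
  foldr push_seq x (wmul u v) = foldr push_seq (foldr push_seq x v) u.
Proof.
move=> rv rx; elim: u => //= a u <-.
case: (wmul u v) => //= b w; case: eqVneq => [->|//].
by rewrite push_seqK//; exact: push_seqs_reduced.
Qed.

Lemma boundary_action_is_action : is_action (boundary_action hr).
Proof.
split=> [x|g h x]; apply: val_inj => //=.
rewrite -push_seq_wmul ?fword_reduced//; exact: set_valP.
Qed.

Lemma nbhs_coord x i : nbhs x [set y | y i = x i].
Proof.
have H := @proj_continuous nat (fun=> discrete_topology (letter r)) i x.
by apply: (H [set x i]); rewrite nbhs_principalE.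
Qed.

Lemma letter_seq_continuous (X : topologicalType) (f : X -> letter_seq r) :
  (forall (x : X) i, nbhs x [set y | f y i = f x i]) -> continuous f.
Proof.
move=> fE x; pose Tc (i : nat) := Topological.class
  (initial_topology (fun y : nat -> discrete_topology (letter r) => y i)).
apply: (iffRL (@cvg_sup _ nat Tc (fmap f (nbhs x)) (f x) _)) => i A.
case=> B [[U oU UB] Bx BA]; apply: filterS (fE x i) => y /= yx.
by apply: BA; move: Bx; rewrite -UB /= yx.
Qed.

Lemma push_seq_continuous a : continuous (push_seq a).
Proof.
apply: letter_seq_continuous => x i.
have H : [set y | y 0%N = x 0%N] `&` [set y | y i.+1 = x i.+1]
    `&` [set y | y i.-1 = x i.-1]
    `<=` [set y | push_seq a y i = push_seq a x i].
  move=> y [[/= y0 yS] yP]; rewrite /push_seq y0; case: ifP => // _.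
  by case: i yP {yS}.
apply: (filterS H).
by apply: filterI; [apply: filterI|]; exact: nbhs_coord.
Qed.

Lemma boundary_action_continuous g : continuous (boundary_action hr g).
Proof.
apply/continuousP => _ [A oA <-].
exists ((fun x => foldr push_seq x g) @^-1` A) => //.
move: A oA; apply/continuousP.
elim: (fword g) => [|a w IH] x /=; first exact: cvg_id.
exact: (@continuous_comp _ _ _ (fun x => foldr push_seq x w) (push_seq a) x
  (IH x) (@push_seq_continuous a _)).
Qed.

Lemma boundary_action_borel :
  @is_borel_action (free_group r) _ (borel_space (boundary hr))
    (boundary_action hr).
Proof.
split=> [|g]; first exact: boundary_action_is_action.
apply: (@measurability _ _ (borel_space (boundary hr))
  (borel_space (boundary hr)) setT (boundary_action hr g)
  (@open (boundary hr))) => //.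
move=> _ [A oA <-]; rewrite setTI; apply: sub_sigma_algebra.
by have /continuousP := @boundary_action_continuous g; exact.
Qed.

End BoundaryActionBorel.

Section Actions.
Variables (R : realType) (G : groupType).

(* [completed_algebra_gen mu] consists of the mu-measurable sets.  The action
   is not assumed to preserve the null sets of [mu]. *)
Definition ergodic d (X : measurableType d) (mu : set X -> \bar R)
    (act : G -> X -> X) : Prop :=
  forall A : set X, completed_algebra_gen mu A ->
    (forall g, act g @` A = A) ->
    mu.-negligible A \/ mu.-negligible (~` A).

Definition measure_preserving d (X : measurableType d) (mu : set X -> \bar R)
    (act : G -> X -> X) : Prop :=
  forall g (A : set X), measurable A -> mu (act g @^-1` A) = mu A.

Definition diagonal_action (X Y : Type) (actX : G -> X -> X)
    (actY : G -> Y -> Y) (g : G) (z : X * Y) : X * Y :=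
  (actX g z.1, actY g z.2).

(* Borel isomorphic to a separable complete metric space, rendered as a complete
   pseudometric space that is Hausdorff. *)
Definition standard_borel d (Y : measurableType d) : Prop :=
  exists (Z : completePseudoMetricType R) (f : Y -> Z),
    [/\ hausdorff_space Z,
        exists2 D : set Z, countable D & dense D,
        bijective f &
        forall A : set Y, measurable A <-> <<s @open Z >> (f @` A)].

Definition weakly_mixing d (X : measurableType d) (mu : set X -> \bar R)
    (act : G -> X -> X) : Prop :=
  forall d' (Y : measurableType d') (nu : probability Y R)
      (actY : G -> Y -> Y),
    standard_borel Y -> is_borel_action actY ->
    measure_preserving nu actY -> ergodic nu actY ->
    ergodic (mu \x nu)%E (diagonal_action act actY).

Definition chains_to d (X : measurableType d) (mu : set X -> \bar R)
    (act : G -> X -> X) (k : nat) (A B : set X) : Prop :=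
  exists gamma : nat -> G,
    [/\ gamma 0%N = 1%g,
        forall i, (i < k)%N ->
          (0 < mu ((act (gamma i) @` A) `&` (act (gamma i.+1) @` A)))%E &
        (0 < mu ((act (gamma k) @` A) `&` B))%E].

Definition chaining d (X : measurableType d) (mu : set X -> \bar R)
    (act : G -> X -> X) (k : nat) : Prop :=
  forall A B : set X, measurable A -> measurable B ->
    (0 < mu A)%E -> (0 < mu B)%E -> chains_to mu act k A B.

Definition boundedly_chaining d (X : measurableType d) (mu : set X -> \bar R)
    (act : G -> X -> X) : Prop :=
  exists k, chaining mu act k.

End Actions.

Section Matrices.
Variables (R : realType) (n : nat).
Implicit Types (P Q : 'M[R]_n) (p : 'rV[R]_n).

Definition row_stochastic P : Prop :=
  (forall i j, 0 <= P i j) /\ (forall i, \sum_j P i j = 1).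

Definition positive_distribution p : Prop :=
  (forall i, 0 < p 0 i) /\ \sum_i p 0 i = 1.

Definition stationary P p : Prop := p *m P = p.

Definition irreducible_mx Q : Prop :=
  forall i j, exists2 k : nat, (1 <= k)%N & 0 < (Q ^+ k) i j.

Definition strictly_irreducible P : Prop :=
  irreducible_mx P /\ irreducible_mx (P *m P^T).

End Matrices.

Section Markov.
Variables (R : realType) (r : nat).
Implicit Types (P : 'M[R]_#|{: letter r}|) (p : 'rV[R]_#|{: letter r}|).

Definition lvec p (a : letter r) : R := p 0 (enum_rank a).
Definition lmx P (a b : letter r) : R := P (enum_rank a) (enum_rank b).

Definition weakly_inverse_symmetric P : Prop :=
  forall a b : letter r, b != a -> b != linv a ->
    forall i j : bool, lmx P a b = 0 <-> lmx P (lexp a i) (lexp b j) = 0.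

Definition cylinder (w : seq (letter r)) : set (letter_seq r) :=
  [set x | mkseq x (size w) = w].

Definition is_markov_measure p P (nu : set (letter_seq r) -> \bar R) : Prop :=
  forall (a : letter r) (w : seq (letter r)),
    nu (cylinder (a :: w)) =
      (lvec p a * \prod_(i < size w)
         lmx P (nth a (a :: w) i) (nth a (a :: w) i.+1))%:E.

(* A measure on the space of all sequences supported on the boundary is given
   as the push-forward of a measure on the boundary under the inclusion; as [p]
   is positive, this forces [lmx P a (linv a) = 0]. *)
Definition is_boundary_markov_measure p P (hr : (0 < r)%N)
    (mu : probability (borel_space (boundary hr)) R) : Prop :=
  [/\ row_stochastic P, positive_distribution p &
      is_markov_measure p P (fun A => mu (set_val @^-1` A))].

End Markov.

(* Main.v *)
Require Import Defs.
From HB Require Import structures.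
From mathcomp Require Import all_boot all_order all_algebra.
From mathcomp Require Import all_classical all_reals all_analysis.
From mathcomp Require Import measurable_realfun.
From mathcomp Require Import ring lra zify.
Set Implicit Arguments.
Unset Strict Implicit.
Unset Printing Implicit Defensive.
Import Order.TTheory GRing.Theory Num.Theory.
Local Open Scope classical_set_scope.
Local Open Scope ring_scope.

(* We prove (2) => (1) => (4) => (3), and (3) => (2) is trivial.

   (2) => (1): for an invariant W in X x Y, the map x |-> W_x into the measure
   algebra of Y is equivariant and takes values in a separable space on which
   the group acts by isometries.  The set of x with W_x close to a given point
   is linked to any other such set by a chain of bounded length, so the map is
   a.e. constant.  Its value is invariant because each generator a acts
   nonsingularly on [b] as soon as P(a,b) > 0.

   (1) => (4): if P is reducible, stationarity yields a proper set of letters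
   such that almost no path enters or leaves it, and the sequences eventually
   in that set form an invariant set.  If P is irreducible but PP^t is not, let
   J be the set of classes of letters generated by having a common successor.
   Write e(a) for the class of a and f(a) for the common class of all the
   predecessors of a.  Weak inverse symmetry gives e(a^-1) = e(a) and
   f(a^-1) = f(a), so that a may act on J by the transposition (e(a) f(a)),
   and x |-> f(x_0) is then an equivariant map to J on almost every x.

   (4) => (3): by density A almost fills some cylinder, hence, by
   irreducibility of P, for each letter c some translate g_c A almost fills [d]
   for all successors d of c simultaneously.  So g_c A and g_c' A meet whenever
   c and c' have a common successor, and A and B are chained along a path
   c_1, ..., c_k of the graph of PP^t.  Each letter has two predecessors by
   weak inverse symmetry, so a shortest such path has at most 2r - 1 vertices. *)

(** * The measure algebra of a probability space *)

Section symmetric_difference_distance.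
Context d (T : measurableType d) (R : realType) (P : probability T R).
Implicit Types U V W : set T.

Definition pdist U V : R := fine (P (U `+` V)).

Lemma fine_probabilityK U : measurable U -> (fine (P U))%:E = P U.
Proof. by move=> mU; rewrite fineK// fin_num_measure. Qed.

Lemma probability_le0 U : measurable U -> fine (P U) <= 0 -> P U = 0%E.
Proof.
move=> mU U0; rewrite -fine_probabilityK//; congr EFin.
by apply/eqP; rewrite eq_le U0 fine_ge0.
Qed.

Lemma fine_probability_le U V : measurable U -> measurable V ->
  U `<=` V -> fine (P U) <= fine (P V).
Proof.
by move=> mU mV UV; rewrite -lee_fin !fine_probabilityK// le_measure ?inE.
Qed.

Lemma fine_probabilityU U V W : measurable U -> measurable V -> measurable W ->
  U `<=` V `|` W -> fine (P U) <= fine (P V) + fine (P W).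
Proof.
move=> mU mV mW UVW; rewrite -lee_fin EFinD !fine_probabilityK//.
apply: le_trans (measureU2 _ mV mW).
by rewrite le_measure ?inE//; exact: measurableU.
Qed.

Lemma measurable_setY U V : measurable U -> measurable V ->
  measurable (U `+` V).
Proof.
by move=> mU mV; rewrite setY_def; apply: measurableU; exact: measurableD.
Qed.

Lemma pdist_ge0 U V : 0 <= pdist U V.
Proof. exact: fine_ge0. Qed.

Lemma pdistC U V : pdist U V = pdist V U.
Proof. by rewrite /pdist setYC. Qed.

Lemma pdist_le_add U V U1 V1 U2 V2 :
  measurable U -> measurable V -> measurable U1 -> measurable V1 ->
  measurable U2 -> measurable V2 ->
  U `+` V `<=` (U1 `+` V1) `|` (U2 `+` V2) ->
  pdist U V <= pdist U1 V1 + pdist U2 V2.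
Proof.
move=> mU mV mU1 mV1 mU2 mV2 sub.
by apply: fine_probabilityU => //; exact: measurable_setY.
Qed.

Lemma pdist_triangle V U W : measurable U -> measurable V -> measurable W ->
  pdist U W <= pdist U V + pdist V W.
Proof.
move=> mU mV mW; apply: pdist_le_add => // x; rewrite !setY_def /=.
by case: (pselect (V x)); tauto.
Qed.

Lemma pdistxx U : pdist U U = 0.
Proof. by rewrite /pdist setYK measure0. Qed.

Lemma pdist_le_diff U V : measurable U -> measurable V ->
  fine (P (U `\` V)) <= pdist U V.
Proof.
move=> mU mV; apply: fine_probability_le.
- exact: measurableD.
- exact: measurable_setY.
- by move=> x; rewrite setY_def /=; tauto.
Qed.

Lemma pdist_le_measure U V : measurable U -> measurable V ->
  fine (P U) <= fine (P V) + pdist U V.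
Proof.
move=> mU mV; apply: fine_probabilityU => //; first exact: measurable_setY.
by move=> x; rewrite setY_def /=; case: (pselect (V x)); tauto.
Qed.

Lemma pdist_bigcup (F : (set T)^nat) e : (forall n, measurable (F n)) ->
  {homo F : n m / (n <= m)%N >-> (n <= m)%O} -> 0 < e ->
  exists k, pdist (\bigcup_n F n) (F k) < e.
Proof.
move=> mF ndF e0; have mU : measurable (\bigcup_n F n) by exact: bigcupT_measurable.
have /= := nondecreasing_cvg_mu (mu := P) mF mU ndF.
rewrite -fine_probabilityK// => /fine_cvgP[_ /cvgrPdist_lt/(_ _ e0)[k _ kP]].
exists k; have := kP k (leqnn k); rewrite /= => /ltr_normlW.
have sub : F k `<=` \bigcup_n F n by exact: bigcup_sup.
have mD : measurable ((\bigcup_n F n) `\` F k) by exact: measurableD.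
have -> : fine (P (\bigcup_n F n)) =
    fine (P (F k)) + fine (P ((\bigcup_n F n) `\` F k)).
  rewrite -fineD ?fin_num_measure// -measureU//; last by rewrite setDIK.
  by rewrite setDUK.
rewrite addrC addKr; apply: le_lt_trans; apply: fine_probability_le => //.
  exact: measurable_setY.
by move=> x; rewrite setY_def /= => -[//|[/sub]].
Qed.

(** Dynkin's argument: the sets that [H] approximates arbitrarily well form a lambda-system, because
    errors at most add up under differences and increasing unions are approximated by their terms.
    This system contains the pi-system [G]. *)
Lemma algebra_dense (G H : set (set T)) e A :
  measurable = <<s G >> -> setI_closed G -> G `<=` H -> H `<=` measurable ->
  H setT -> setD_closed H -> 0 < e -> measurable A ->
  exists2 B, H B & pdist A B < e.
Proof.
move=> mE GI GH mH HT HD e0 mA.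
pose K := [set A | measurable A /\
  forall e, 0 < e -> exists2 B, H B & pdist A B < e].
suff : K A by move=> [_]; exact.
have KK : lambda_system setT K.
  split => //.
  - by split => // e1 e10; exists setT => //; rewrite pdistxx.
  - move=> U V _ [mU KU] [mV KV]; split; first exact: measurableD.
    move=> e1 e10; have e20 : 0 < e1 / 2 by rewrite divr_gt0.
    have [U' HU' dU] := KU _ e20; have [V' HV' dV] := KV _ e20.
    exists (U' `\` V'); first exact: HD.
    rewrite (splitr e1); apply: le_lt_trans (ltrD dU dV).
    apply: pdist_le_add => //; try exact: mH; first exact: measurableD.
      by apply: measurableD; exact: mH.
    move=> x; rewrite !setY_def /=.
    by case: (pselect (U' x)); case: (pselect (V x)); case: (pselect (V' x)); tauto.
  - move=> F ndF KF; have mF n : measurable (F n) by case: (KF n).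
    have mU : measurable (\bigcup_n F n) by exact: bigcupT_measurable.
    split => // e1 e10; have e20 : 0 < e1 / 2 by rewrite divr_gt0.
    have [k dk] := pdist_bigcup mF ndF e20.
    have [B HB dB] := (KF k).2 _ e20; exists B => //.
    rewrite (splitr e1); apply: le_lt_trans (ltrD dk dB).
    by apply: pdist_triangle => //; exact: mH.
apply: (lambda_system_subset GI KK) => //; last by rewrite -mE.
move=> B GB; split; first by apply/mH/GH.
by move=> e1 e10; exists B; rewrite ?pdistxx//; exact: GH.
Qed.

End symmetric_difference_distance.

(** * Separability of the sections of a measurable set *)

Section xsection_separability.
Context d d' (X : measurableType d) (Y : measurableType d') (R : realType).
Variable (nu : probability Y R).

(** [Y] is arbitrary here: the sections of a single [W] already lie in a separable part of its
    measure algebra. This is clear for rectangles and passes to proper differences and increasing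
    unions by halving [e]. *)
Lemma xsection_separable (W : set (X * Y)) : measurable W ->
  forall e, 0 < e -> exists2 F : (set Y)^nat, forall n, measurable (F n) &
    forall x, exists n, pdist nu (xsection W x) (F n) < e.
Proof.
pose K := [set A : set (X * Y) | measurable A /\ forall e : R, 0 < e ->
  exists2 F : (set Y)^nat, forall n, measurable (F n) &
    forall x, exists n, pdist nu (xsection A x) (F n) < e].
move=> mW; suff [] : K W by [].
move: mW; rewrite measurable_prod_measurableType; apply: lambda_system_subset => //.
- move=> _ _ [A1 mA1 [A2 mA2 <-]] [B1 mB1 [B2 mB2 <-]].
  exists (A1 `&` B1); first exact: measurableI.
  by exists (A2 `&` B2); [exact: measurableI|rewrite setXI].
- split => //.
  + split => // e e0; exists (fun=> setT) => // x; exists 0%N.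
    rewrite (_ : xsection _ _ = setT) ?pdistxx//.
    by apply/seteqP; split=> // y _; rewrite /xsection /= inE.
  + move=> U V VU [mU KU] [mV KV]; split; first exact: measurableD.
    move=> e e0; have e20 : 0 < e / 2 by rewrite divr_gt0.
    have [F mF dF] := KU _ e20; have [G mG dG] := KV _ e20.
    (* One sequence runs through all pairs [(i, j)]; indices coding no pair give the harmless value
       [set0]. *)
    exists (fun n => if unpickle n is Some (i, j) then F i `\` G j else set0).
      by move=> n; case: unpickle => [[i j]|] //; exact: measurableD.
    move=> x; have [i di] := dF x; have [j dj] := dG x.
    exists (pickle (i, j)); rewrite pickleK (splitr e).
    apply: le_lt_trans (ltrD di dj); rewrite xsectionD.
    have mxU := measurable_xsection x mU; have mxV := measurable_xsection x mV.
    apply: pdist_le_add => //; try exact: measurableD.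
    move=> y; rewrite !setY_def /=; set P1 := xsection U x; set P2 := xsection V x.
    by case: (pselect (F i y)); case: (pselect (P2 y)); case: (pselect (G j y)); tauto.
  + move=> A ndA KA; have mA n : measurable (A n) by case: (KA n).
    have mU : measurable (\bigcup_n A n) by exact: bigcupT_measurable.
    split => // e e0; have e20 : 0 < e / 2 by rewrite divr_gt0.
    have /choice[F FP] k : exists F : (set Y)^nat, (forall n, measurable (F n)) /\
        forall x, exists n, pdist nu (xsection (A k) x) (F n) < e / 2.
      by have [F] := (KA k).2 _ e20; exists F.
    exists (fun n => if unpickle n is Some (i, j) then F i j else set0).
      by move=> n; case: unpickle => [[i j]|] //; exact: (FP i).1.
    move=> x; have mxA n := measurable_xsection x (mA n).
    have ndx : {homo (fun n => xsection (A n) x) : n m / (n <= m)%N >-> (n <= m)%O}.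
      by move=> n m nm; apply/subsetPset/le_xsection/subsetPset/ndA.
    have [k] := pdist_bigcup nu mxA ndx e20; rewrite -xsection_bigcup => dk.
    have [j dj] := (FP k).2 x.
    exists (pickle (k, j)); rewrite pickleK (splitr e).
    apply: le_lt_trans (ltrD dk dj); apply: pdist_triangle => //.
    * exact: measurable_xsection.
    * exact: (FP k).1.
- move=> _ [A mA [B mB <-]]; split; first exact: measurableX.
  (* A rectangle has only the two sections [B] and [set0]. *)
  move=> e e0; exists (fun n => if n is 0%N then B else set0) => [[|n]//|x].
  have [xA|xA] := boolP (x \in A).
    by exists 0%N; rewrite in_xsectionX// pdistxx.
  by exists 1%N; rewrite notin_xsectionX// pdistxx.
Qed.

End xsection_separability.

(** * Actions and cylinders *)

Section actions.
Variables (G : groupType) (X : Type) (act : G -> X -> X).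
Hypothesis actP : is_action act.

Lemma act1 x : act 1%g x = x. Proof. exact: actP.1. Qed.

Lemma actM g h x : act (g * h)%g x = act g (act h x). Proof. exact: actP.2. Qed.

Lemma actK g : cancel (act g) (act g^-1%g).
Proof. by move=> x; rewrite -actM mulVg act1. Qed.

Lemma actKV g : cancel (act g^-1%g) (act g).
Proof. by move=> x; rewrite -actM mulgV act1. Qed.

Lemma act_imageE g A : act g @` A = act g^-1%g @^-1` A.
Proof.
apply/seteqP; split => x /=; first by move=> [y Ay <-]; rewrite actK.
by move=> Ax; exists (act g^-1%g x) => //; rewrite actKV.
Qed.

Lemma act_image1 A : act 1%g @` A = A.
Proof.
by rewrite act_imageE /= invg1; apply/seteqP; split => x /=; rewrite act1.
Qed.

Lemma act_imageM g h A : act (g * h)%g @` A = act g @` (act h @` A).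
Proof.
by rewrite !act_imageE invgM; apply/seteqP; split => x /=; rewrite actM.
Qed.

Lemma act_imageI g A B : act g @` (A `&` B) = (act g @` A) `&` (act g @` B).
Proof. by rewrite !act_imageE. Qed.

Lemma act_imageD g A B : act g @` (A `\` B) = (act g @` A) `\` (act g @` B).
Proof. by rewrite !act_imageE. Qed.

End actions.

Lemma borel_act_image (G : groupType) d (X : measurableType d)
    (act : G -> X -> X) g A : is_borel_action act ->
  measurable A -> measurable (act g @` A).
Proof.
move=> [actP actB] mA; rewrite act_imageE// -[X in measurable X]setTI.
exact: actB.
Qed.

Lemma countable_bigcup_measurable d (T : sigmaRingType d) (U : countType)
    (D : set U) (F : U -> set T) :
  (forall u, D u -> measurable (F u)) -> measurable (\bigcup_(u in D) F u).
Proof.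
move=> mF; rewrite bigcup_mkcond; apply: countable_bigcupT_measurable => [|u].
  exact: countableP.
by case: ifPn => [|_]; [rewrite inE => /mF|].
Qed.

(** * Generators and words of the free group *)

Section words.
Variable r : nat.
Implicit Types (a b : letter r) (w : seq (letter r)).

Definition gen a : free_group r := @FreeWord r [:: a] isT.

(** A product in the group, so that any list of letters is allowed, reduced or not. *)
Definition word w : free_group r := foldr (fun a g => gen a * g)%g 1%g w.

Lemma gen_linv a : (gen (linv a) = (gen a)^-1)%g.
Proof. exact: val_inj. Qed.

Lemma word_fword (g : free_group r) : word (fword g) = g.
Proof.
apply: val_inj; case: g => w /=; elim: w => [|a w IH] rw //=.
rewrite IH ?push_reduced//; exact: path_sorted rw.
Qed.

Lemma free_group_ind (K : free_group r -> Prop) :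
  K 1%g -> (forall a g, K g -> K (gen a * g)%g) -> forall g, K g.
Proof.
by move=> K1 KM g; rewrite -(word_fword g); elim: (fword g) => //= a w; exact: KM.
Qed.

Lemma linv_neq a : linv a != a.
Proof. by case: a => i e; rewrite /linv -pair_eqE /pair_eq /= eqxx /=; case: e. Qed.

End words.

(** * Cylinders of the boundary *)

Section cylinders.
Variables (r : nat) (hr : (0 < r)%N).
Implicit Types (a b d : letter r) (u w : seq (letter r)).
Local Notation X := (borel_space (boundary hr)).

(* The boundary action, with its carrier retyped as a measurable space. *)
Definition bact (g : free_group r) (x : X) : X := boundary_action hr g x.
Local Notation act := bact.

Lemma bact_borel : is_borel_action bact.
Proof. exact: (boundary_action_borel hr). Qed.

Lemma bact_action : is_action bact. Proof. exact: bact_borel.1. Qed.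

Definition coord (x : X) : nat -> letter r := set_val x.

Definition cyl w : set X := set_val @^-1` cylinder w.

Lemma cylP w (x : X) : cyl w x <-> mkseq (coord x) (size w) = w.
Proof. by []. Qed.

Lemma mkseq_cons T (f : nat -> T) n :
  mkseq f n.+1 = f 0%N :: mkseq (fun i => f i.+1) n.
Proof. by rewrite /mkseq /= (iotaDl 1 0 n) -map_comp. Qed.

Lemma take_mkseq T (f : nat -> T) m n : (m <= n)%N ->
  take m (mkseq f n) = mkseq f m.
Proof. by move=> mn; rewrite /mkseq -map_take take_iota (minn_idPl mn). Qed.

Lemma cylS a w (x : X) : cyl (a :: w) x <->
  coord x 0 = a /\ mkseq (fun i => coord x i.+1) (size w) = w.
Proof.
by rewrite cylP /= mkseq_cons; split => [[]|[-> ->]].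
Qed.

Lemma cyl_mkseq (x : X) n : cyl (mkseq (coord x) n) x.
Proof. by rewrite cylP size_mkseq. Qed.

Lemma cyl_cat u w : cyl (u ++ w) `<=` cyl u.
Proof.
move=> x /cylP /(congr1 (take (size u))).
by rewrite take_mkseq ?size_cat ?leq_addr// take_size_cat.
Qed.

Lemma cyl0 : cyl [::] = setT.
Proof. by apply/seteqP; split. Qed.

Lemma cyl_disjoint u w (x : X) : size u = size w -> cyl u x -> cyl w x -> u = w.
Proof. by move=> su /cylP <- /cylP <-; rewrite su. Qed.

Lemma coord_reduced (x : X) i : coord x i.+1 <> linv (coord x i).
Proof. by have := @set_valP _ _ x; exact. Qed.

Lemma coord_gen a (x : X) : coord (act (gen a) x) = push_seq a (coord x).
Proof. by []. Qed.

Lemma coord_gen_cancel a (x : X) n : coord x 0 = linv a ->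
  coord (act (gen a) x) n = coord x n.+1.
Proof. by move=> /eqP x0; rewrite coord_gen /push_seq x0. Qed.

Lemma coord_gen_push a (x : X) n : coord x 0 <> linv a ->
  coord (act (gen a) x) n = if n is m.+1 then coord x m else a.
Proof. by move=> /eqP/negPf x0; rewrite coord_gen /push_seq x0. Qed.

(** As [b] is not [linv a], nothing cancels. Conversely, if [x] does not start with [a], then
    [linv a] is prepended to it, and the result cannot start with [b]. *)
Lemma act_gen_cyl a b w : b != linv a ->
  act (gen a) @` cyl (b :: w) = cyl [:: a, b & w].
Proof.
move=> ba; rewrite act_imageE; last exact: bact_action.
rewrite -gen_linv; apply/seteqP; split => x /=.
- move=> /cylS[x0 xw]; have [x0a|x0a] := pselect (coord x 0 = a).
    move: x0 xw; rewrite coord_gen_cancel ?linvK// => x0 xw.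
    rewrite cylS x0a /= mkseq_cons x0; split => //.
    rewrite -[in RHS]xw; congr cons; apply: eq_mkseq => i.
    by rewrite coord_gen_cancel ?linvK.
  by move: x0; rewrite coord_gen_push ?linvK// => x0; rewrite -x0 eqxx in ba.
- rewrite cylS /= mkseq_cons => -[x0 [x1 xw]]; rewrite cylS.
  rewrite coord_gen_cancel ?linvK//; split => //.
  rewrite -[in RHS]xw; apply: eq_mkseq => i.
  by rewrite coord_gen_cancel ?linvK.
Qed.

Lemma open_cyl w : open (cyl w : set (boundary hr)).
Proof.
elim/last_ind: w => [|w a IH]; first by rewrite cyl0; exact: openT.
have -> : cyl (rcons w a) = cyl w `&` [set x | coord x (size w) = a].
  apply/seteqP; split => x /=.
  - move=> /cylP; rewrite size_rcons mkseqS => /rcons_inj[xw xa].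
    by split => //; apply/cylP.
  - by move=> [/cylP xw xa]; rewrite cylP size_rcons mkseqS xw xa.
apply: openI => //; exists [set y : letter_seq r | y (size w) = a] => //.
by rewrite openE => y /= <-; exact: nbhs_coord.
Qed.

Lemma measurable_cyl w : measurable (cyl w).
Proof. by apply: sub_sigma_algebra; exact: open_cyl. Qed.

Lemma cylinder_mkseqP (x y : letter_seq r) n :
  cylinder (mkseq x n) y <-> forall i, (i < n)%N -> y i = x i.
Proof.
rewrite /cylinder /= size_mkseq; split => [yx i ilt|yx].
  by have := congr1 (nth (y i) ^~ i) yx; rewrite !nth_mkseq.
apply: (@eq_from_nth _ (y 0%N)); rewrite ?size_mkseq// => i ilt.
by rewrite !nth_mkseq// yx.
Qed.

(** The sets containing a cylinder around [x] form a filter. It converges to [x] in the product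
    topology, since the cylinder of length [i.+1] fixes coordinate [i]. *)
Lemma nbhs_cylinder (x : letter_seq r) (U : set (letter_seq r)) :
  nbhs x U -> exists n, cylinder (mkseq x n) `<=` U.
Proof.
pose F : set_system (letter_seq r) :=
  [set U | exists n, cylinder (mkseq x n) `<=` U].
have FF : Filter F.
  split.
  - by exists 0%N.
  - move=> A B [n nA] [m mB]; exists (maxn n m) => y /cylinder_mkseqP yx.
    split; [apply: nA|apply: mB]; apply/cylinder_mkseqP => i ilt; apply: yx.
      by rewrite (leq_trans ilt) ?leq_maxl.
    by rewrite (leq_trans ilt) ?leq_maxr.
  - by move=> A B AB [n nA]; exists n; apply: subset_trans AB.
suff : F --> x by apply.
pose Tc (i : nat) := Topological.class
  (initial_topology (fun y : nat -> discrete_topology (letter r) => y i)).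
apply: (iffRL (@cvg_sup _ nat Tc F x _)) => i A.
case=> B [[V oV VB] Bx BA]; exists i.+1 => y.
move=> /cylinder_mkseqP /(_ _ (ltnSn i)) yx.
by apply: BA; move: Bx; rewrite -VB /= yx.
Qed.

Lemma open_bigcup_cyl (U : set X) : open (U : set (boundary hr)) ->
  U = \bigcup_(w in [set w | cyl w `<=` U]) cyl w.
Proof.
move=> [V oV VU]; apply/seteqP; split => [x Ux|x [w wU] /wU//].
have Vx : nbhs (set_val x) V.
  by apply: open_nbhs_nbhs; split => //; rewrite -VU in Ux.
have [n nV] := nbhs_cylinder Vx; exists (mkseq (coord x) n) => /=.
  by move=> y yc; rewrite -VU; exact: nV.
exact: cyl_mkseq.
Qed.

(** The empty set is included to make this a pi-system. *)
Definition cyls : set (set X) := [set A | A = set0 \/ exists w, A = cyl w].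

Lemma cyls_generate : measurable = <<s cyls >>.
Proof.
apply/seteqP; split; last first.
  apply: smallest_sub; first exact: sigma_algebra_measurable.
  by move=> _ [->|[w ->]] //; exact: measurable_cyl.
apply: smallest_sub; first exact: smallest_sigma_algebra.
move=> U oU; rewrite (open_bigcup_cyl oU).
apply: (@countable_bigcup_measurable _ (g_sigma_algebraType cyls)) => // w _.
apply: sub_sigma_algebra; right; by exists w.
Qed.

(** Two cylinders are nested or disjoint, according to whether the shorter word is a prefix of the
    longer one. *)
Lemma setI_closed_cyls : setI_closed cyls.
Proof.
have E u w : cyls (cyl u `&` cyl w).
  wlog uw : u w / (size u <= size w)%N.
    by move=> H; case/orP: (leq_total (size u) (size w)) => /H//; rewrite setIC.
  have [utw|utw] := eqVneq u (take (size u) w).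
    right; exists w; apply/setIidPr; rewrite -(cat_take_drop (size u) w) -utw.
    exact: cyl_cat.
  left; apply/seteqP; split => // x [/cylP xu /cylP xw].
  by case/eqP: utw; rewrite -xw take_mkseq.
by move=> _ _ [->|[u ->]] [->|[w ->]]; rewrite ?set0I ?setI0//; left.
Qed.

End cylinders.
Arguments cyl {r} hr w.
Arguments bact {r} hr g x.
Arguments bact_borel {r} hr.
Arguments bact_action {r} hr.
Arguments measurable_cyl {r} hr w.

(** * Markov measures *)

Section markov_measure.
Variables (R : realType) (r : nat) (hr : (0 < r)%N).
Local Notation X := (borel_space (boundary hr)).
Local Notation act := (bact hr).
Variables (P : 'M[R]_#|{: letter r}|) (p : 'rV[R]_#|{: letter r}|).
Variable mu : probability X R.
Hypothesis muP : is_boundary_markov_measure p P mu.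
Implicit Types (a b c d : letter r) (u w : seq (letter r)) (A E : set X).
Local Notation "''p_' a" := (lvec p a) (at level 8, a at level 2, format "''p_' a").

Definition succ a b : bool := 0 < lmx P a b.

(** The probability that the chain, once at [a], continues with [w]. *)
Fixpoint weight a w : R := if w is b :: w' then lmx P a b * weight b w' else 1.

Lemma lmx_ge0 a b : 0 <= lmx P a b.
Proof. by case: muP => -[P0 _] _ _; exact: P0. Qed.

Lemma lmx_eq0 a b : (lmx P a b == 0) = ~~ succ a b.
Proof. by rewrite /succ lt0r lmx_ge0 andbT negbK. Qed.

Lemma sum_lmx a : \sum_b lmx P a b = 1.
Proof.
case: muP => -[_ P1] _ _; rewrite -(P1 (enum_rank a)).
by rewrite [RHS](reindex enum_rank)//; exact: onW_bij (@enum_rank_bij _).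
Qed.

Lemma lvec_gt0 a : 0 < 'p_a.
Proof. by case: muP => _ [p0 _] _; exact: p0. Qed.

Lemma weight_gt0 a w : (0 < weight a w) = path succ a w.
Proof.
elim: w a => /= [a|b w IH a]; first by rewrite ltr01.
rewrite -IH /succ; have := lmx_ge0 a b; rewrite le_eqVlt => /predU1P[<-|ab].
  by rewrite mul0r ltxx.
by rewrite ab pmulr_rgt0.
Qed.

Lemma weight_cat a u w : weight a (u ++ w) = weight a u * weight (last a u) w.
Proof. by elim: u a => /= [a|b u IH a]; rewrite ?mul1r// IH mulrA. Qed.

Lemma mu_cyl a w : mu (cyl hr (a :: w)) = ('p_a * weight a w)%:E.
Proof.
case: muP => _ _ /(_ a w) ->; congr (_ * _)%:E.
suff H x b v : \prod_(i < size v) lmx P (nth x (b :: v) i) (nth x (b :: v) i.+1)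
    = weight b v by exact: H.
elim: v b => /= [|c v IH] b; first by rewrite big_ord0.
by rewrite big_ord_recl -IH.
Qed.

Lemma mu_cyl_gt0 a w : (0 < mu (cyl hr (a :: w)))%E = path succ a w.
Proof. by rewrite mu_cyl lte_fin pmulr_rgt0 ?lvec_gt0// weight_gt0. Qed.

Lemma cyl_linv a w : cyl hr [:: a, linv a & w] = set0.
Proof.
apply/seteqP; split => // x /cylS[x0 /=].
rewrite mkseq_cons => -[x1 _]; apply: (@coord_reduced _ _ x 0).
by rewrite x0 x1.
Qed.

(** The cylinder of [a] followed by [linv a] is empty, while the initial mass of [a] is positive. *)
Lemma succ_linv a : succ a (linv a) = false.
Proof.
by have := mu_cyl_gt0 a [:: linv a]; rewrite cyl_linv measure0 ltxx /= andbT.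
Qed.

Lemma succ_neq a b : succ a b -> b != linv a.
Proof. by apply: contraTneq => ->; rewrite succ_linv. Qed.

Lemma exists_succ a : exists b, succ a b.
Proof.
apply: contrapT => /forallNP H.
have : \sum_b lmx P a b = 0.
  by apply: big1 => b _; apply/eqP; rewrite lmx_eq0; apply/negP.
by rewrite sum_lmx => /eqP; rewrite oner_eq0.
Qed.

Let actP : is_action act := bact_action hr.
Let actB : is_borel_action act := bact_borel hr.

Lemma measurable_act g A : measurable A -> measurable (act g @` A).
Proof. exact: borel_act_image actB. Qed.

(** Prepending [a] to a cylinder inside [[d]] multiplies its measure by a constant: the new path
    gains the transition from [a] to [d] and trades the initial factor of [d] for that of [a].
    Uniqueness of measures extends this to all [E]. The constant may be zero. *)
Lemma mu_act_gen a d E : d != linv a -> measurable E -> E `<=` cyl hr [:: d] ->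
  fine (mu (act (gen a) @` E)) = 'p_a * lmx P a d / 'p_d * fine (mu E).
Proof.
move=> da mE Ed.
have k0 : 0 <= 'p_a * lmx P a d / 'p_d.
  by rewrite divr_ge0 ?mulr_ge0 ?lmx_ge0// ltW// lvec_gt0.
have mD := measurable_cyl hr [:: d].
have mC := measurable_cyl hr [:: a; d].
(* Both sides are finite measures carried by [[d]], so it suffices to compare them on cylinders. *)
have H : forall A, measurable A ->
    pushforward (mrestr mu mC) (act (gen a)^-1%g) A =
    mscale (NngNum k0) (mrestr mu mD) A.
  have key w : mu ((act (gen a) @` cyl hr w) `&` cyl hr [:: a; d]) =
      (('p_a * lmx P a d / 'p_d)%:E * mu (cyl hr w `&` cyl hr [:: d]))%E.
    rewrite -(act_gen_cyl _ _ da) -act_imageI//.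
    have [[{}w ->]|->] : (exists w', cyl hr w `&` cyl hr [:: d] = cyl hr (d :: w')) \/
        cyl hr w `&` cyl hr [:: d] = set0.
    - case: w => [|b w]; first by left; exists [::]; rewrite cyl0 setTI.
      have [<-|bd] := eqVneq b d.
        by left; exists w; apply/setIidPl; rewrite -(cat1s b w); exact: cyl_cat.
      right; apply/seteqP; split => // x [/cylS[x0 _] /cylS[x0' _]].
      by rewrite -x0 x0' eqxx in bd.
    - rewrite act_gen_cyl// !mu_cyl -EFinM /=; congr EFin.
by field; rewrite gt_eqF// lvec_gt0.
    - by rewrite image_set0 measure0 mule0.
  apply: (measure_unique (@cyls r hr) (fun=> setT)).
  - exact: cyls_generate.
  - exact: setI_closed_cyls.
  - by move=> _; right; exists [::]; rewrite cyl0.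
  - by rewrite bigcup_const//; exists 0%N.
  - exact: actB.2.
  - move=> mf _ [->|[w ->]]; first by rewrite !measure0.
    by rewrite /= /pushforward /mrestr /mscale /= -act_imageE.
  - move=> mf _; rewrite /= /pushforward /mrestr /=.
    by rewrite preimage_setT setTI ltey_eq fin_num_measure.
have := H E mE; rewrite /pushforward /mrestr /mscale /= -act_imageE//.
rewrite -(act_gen_cyl _ _ da) -act_imageI// (setIidl Ed) => ->.
by rewrite /mrestr (setIidl Ed) fineM ?fin_num_measure.
Qed.

Lemma act_word_cyl a u d : path succ a (rcons u d) ->
  act (word (a :: u)) @` cyl hr [:: d] = cyl hr (a :: rcons u d).
Proof.
elim: u a => [|b u IH] a /=.
  by rewrite andbT mulg1 => /succ_neq; exact: act_gen_cyl.
move=> /andP[/succ_neq ab bu]; rewrite act_imageM// IH//.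
exact: act_gen_cyl.
Qed.

(** The factors of [mu_act_gen] telescope along the word: the initial masses of the intermediate
    letters cancel. *)
Lemma mu_act_word a u d E : path succ a (rcons u d) ->
  measurable E -> E `<=` cyl hr [:: d] ->
  fine (mu (act (word (a :: u)) @` E)) =
    'p_a * weight a (rcons u d) / 'p_d * fine (mu E).
Proof.
move=> + mE Ed; elim: u a => [|b u IH] a /=.
  by rewrite andbT mulg1 mulr1 => /succ_neq ab; rewrite (mu_act_gen ab).
move=> /andP[/succ_neq ab bu].
have := act_word_cyl (a := b) bu => bE.
rewrite act_imageM// (@mu_act_gen _ b)//.
- by rewrite (IH b)// !mulrA; congr (_ * _ * _); field; rewrite !gt_eqF ?lvec_gt0.
- exact: measurable_act.
- apply: subset_trans (cyl_cat (w := rcons u d)); rewrite /= -bE.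
  exact: image_subset.
Qed.

End markov_measure.

(** * Strict irreducibility implies chaining *)

Section density.
Variables (R : realType) (r : nat) (hr : (0 < r)%N).
Local Notation X := (borel_space (boundary hr)).
Local Notation act := (bact hr).
Variables (P : 'M[R]_#|{: letter r}|) (p : 'rV[R]_#|{: letter r}|).
Variable mu : probability X R.
Hypothesis muP : is_boundary_markov_measure p P mu.
Implicit Types (a b c d : letter r) (u w : seq (letter r)) (A B E : set X).

(** The algebra of finite unions of cylinders. At least one letter is read, so that the words
    involved are non-empty and [mu_cyl] applies to them. *)
Definition finite_level : set (set X) := [set B | exists n, forall x y : X,
  mkseq (coord x) n.+1 = mkseq (coord y) n.+1 -> B x -> B y].

Lemma finite_levelP B : finite_level B ->
  exists n, B = \bigcup_(w in [set w | size w = n.+1 /\ cyl hr w `<=` B]) cyl hr w.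
Proof.
move=> [n nB]; exists n; apply/seteqP; split => [x Bx|x [w [_ wB]] /wB//].
exists (mkseq (coord x) n.+1); last exact: cyl_mkseq.
split; rewrite ?size_mkseq// => y /cylP; rewrite size_mkseq => yx.
exact: nB Bx.
Qed.

Lemma measurable_finite_level : finite_level `<=` measurable.
Proof.
move=> B /finite_levelP[n ->].
by apply: countable_bigcup_measurable => w _; exact: measurable_cyl.
Qed.

Lemma cyls_finite_level : cyls (hr := hr) `<=` finite_level.
Proof.
move=> _ [->|[w ->]]; first by exists 0%N.
exists (size w) => x y xy /cylP xw; apply/cylP.
by rewrite -(take_mkseq _ (leqnSn _)) -xy take_mkseq.
Qed.

Lemma setD_closed_finite_level : setD_closed finite_level.
Proof.
move=> A B [n nA] [m mB]; exists (maxn n m) => x y xy [Ax Bx].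
have H k : (k <= maxn n m)%N -> mkseq (coord x) k.+1 = mkseq (coord y) k.+1.
  by move=> km; rewrite -(take_mkseq _ (km : (k.+1 <= (maxn n m).+1)%N)) xy take_mkseq.
split; first exact: nA (H _ (leq_maxl _ _)) Ax.
by move=> By; apply: Bx; exact: mB (esym (H _ (leq_maxr _ _))) By.
Qed.

Lemma mu_cyl_sum n E : measurable E ->
  (mu E = \sum_(w : n.-tuple (letter r)) mu (E `&` cyl hr w))%E.
Proof.
move=> mE; rewrite -big_enum fsbig_seq ?enum_uniq// -measure_fin_bigcup//.
- rewrite -setI_bigcupr; congr (mu _); apply/esym/setIidPl => x _.
  exists [tuple of mkseq (coord x) n]; rewrite /= ?mem_enum//.
  exact: cyl_mkseq.
- move=> u w _ _ [x [[_ xu] [_ xw]]].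
  by apply/val_inj/(cyl_disjoint _ xu xw); rewrite !size_tuple.
- by move=> w _; apply: measurableI => //; exact: measurable_cyl.
Qed.

(** An elementary density theorem. If [A] missed more than the proportion [e] of every cylinder of
    positive measure, it would miss the proportion [e] of any finite-level set [B], which is
    impossible for [B] close to [A]. *)
Lemma exists_dense_cyl A e : measurable A -> (0 < mu A)%E -> 0 < e ->
  exists a w, path (succ P) a w /\
    fine (mu (cyl hr (a :: w) `\` A)) <= e * fine (mu (cyl hr (a :: w))).
Proof.
move=> mA A0 e0; apply: contrapT => H.
have {}A0 : 0 < fine (mu A) by rewrite fine_gt0// A0 ltey_eq fin_num_measure.
(* Chosen so that [del * (1 + e)] is half of [e * mu A]. This contradicts [e * (mu A - del) <= e *
   mu B <= mu (B \ A) <= del]. *)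
pose del := e * fine (mu A) / (2 * (1 + e)).
have e10 : 0 < 2 * (1 + e) by lra.
have del0 : 0 < del by rewrite divr_gt0// mulr_gt0.
have [B HB dB] := algebra_dense mu (cyls_generate hr)
  (@setI_closed_cyls r hr) cyls_finite_level measurable_finite_level
  (ex_intro _ 0%N (fun _ _ _ _ => I)) setD_closed_finite_level del0 mA.
have mB := measurable_finite_level HB.
have eB : e * fine (mu B) <= fine (mu (B `\` A)).
  have [n BE] := finite_levelP HB.
  rewrite -lee_fin EFinM !fine_probabilityK//; last exact: measurableD.
  rewrite (mu_cyl_sum n.+1 mB) (mu_cyl_sum n.+1 (measurableD mB mA)).
  rewrite ge0_sume_distrr//; apply: lee_sum => w _.
  have mw := measurable_cyl hr w.
  have [wB|wB] := pselect (cyl hr w `<=` B).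
    have -> : (B `\` A) `&` cyl hr w = cyl hr w `\` A.
      by apply/seteqP; split => x /=; have := wB x; tauto.
    rewrite (setIidr wB).
    case: w mw {wB} => -[|a w] //= _ mw.
    rewrite -(fine_probabilityK mu mw) -(fine_probabilityK mu (measurableD mw mA)).
    rewrite -EFinM lee_fin.
    have [pw|pw] := boolP (path (succ P) a w).
      by apply/ltW; rewrite ltNge; apply/negP => wA; apply: H; exists a, w.
    suff -> : mu (cyl hr (a :: w)) = 0%E by rewrite mulr0 fine_ge0.
    apply/eqP; rewrite eq_le measure_ge0 andbT leNgt.
    by rewrite (mu_cyl_gt0 muP).
  suff -> : B `&` cyl hr w = set0 by rewrite measure0 mule0.
  apply/seteqP; split => // x [+ xw]; rewrite {1}BE => -[u [su uB] xu].
  by apply: wB; rewrite -(cyl_disjoint _ xu xw)// su size_tuple.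
have dAB := pdist_le_measure mu mA mB.
have dBA := pdist_le_diff mu mB mA; rewrite pdistC in dBA.
have : del * (2 * (1 + e)) = e * fine (mu A) by rewrite /del; field; lra.
set al := fine (mu A) in A0 dAB *; set be := fine (mu B) in eB dAB *.
set ga := fine (mu (B `\` A)) in eB dBA *; set di := pdist mu A B in dB dAB dBA *.
clearbody al be ga di del; nra.
Qed.

Lemma pos_lower_bound (T : finType) (f : T -> R) : (forall t, 0 < f t) ->
  exists2 e, 0 < e & forall t, e <= f t.
Proof.
move=> f0; exists (\big[Num.min/1]_t f t).
  by elim/big_ind: _ => // x y x0 y0; rewrite lt_min x0.
by move=> t; rewrite (bigD1 t)//= ge_min lexx.
Qed.

(* Once [A] almost fills [w], it also almost fills all the cylinders [w v c d]
   with [v] of bounded length; pulling back by [w v c] scales the measure. *)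
Lemma exists_filling A c e : (forall a b, exists u, path (succ P) a (rcons u b)) ->
  measurable A -> (0 < mu A)%E -> 0 < e ->
  exists g, forall d, succ P c d ->
    fine (mu (cyl hr [:: d] `\` act g @` A)) < e.
Proof.
move=> con mA A0 e0; have /choice[u uP] a := con a c.
pose v a := rcons (u a) c.
(* A lower bound for the finitely many weights that can occur; pairs where [d] does not follow [c]
   get the dummy value 1. *)
have [f f0 fP] : exists2 f, 0 < f &
    forall a d, succ P c d -> f <= weight P a (rcons (v a) d).
  have [|f f0 fP] := @pos_lower_bound (letter r * letter r)%type (fun t =>
      if succ P c t.2 then weight P t.1 (rcons (v t.1) t.2) else 1).
    move=> [a d] /=; case: ifPn => // cd.
    by rewrite (weight_gt0 muP) rcons_path uP last_rcons.
  by exists f => // a d cd; have := fP (a, d); rewrite /= cd.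
(* Pulling back to [[d]] multiplies the relative error by at most [1 / f], as [lvec p d <= 1]; the
   factor 1/2 makes the final bound strict. *)
have ef0 : 0 < e * f / 2 by rewrite !mulr_gt0// invr_gt0.
have [a [w [aw wA]]] := exists_dense_cyl mA A0 ef0.
pose b := last a w.
exists (word (a :: w ++ v b))^-1%g => d cd.
set g := word _; set E := _ `\` _.
have actP := bact_action hr.
have mgA : measurable (act g^-1%g @` A) by apply: measurable_act.
have mE : measurable E by apply: measurableD => //; exact: measurable_cyl.
have pw : path (succ P) a (rcons (w ++ v b) d).
  by rewrite -cats1 -catA cats1 cat_path aw rcons_path uP last_rcons.
have gE : act g @` E = cyl hr (a :: rcons (w ++ v b) d) `\` A.
  rewrite act_imageD// (act_word_cyl muP pw) -act_imageM// mulgV.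
  by rewrite act_image1.
have := mu_act_word muP pw mE (@subDsetl _ _ _); rewrite -/g gE.
have : fine (mu (cyl hr (a :: rcons (w ++ v b) d) `\` A)) <=
    e * f / 2 * fine (mu (cyl hr (a :: w))).
  apply: le_trans wA; apply: fine_probability_le.
  - by apply: measurableD => //; exact: measurable_cyl.
  - by apply: measurableD => //; exact: measurable_cyl.
  - apply: setSD; rewrite -cats1 -catA -cat_cons; exact: cyl_cat.
rewrite (mu_cyl muP) /= -cats1 -catA cats1 weight_cat -/b => /[swap] ->.
have := fP b d cd; have := lvec_gt0 muP a; have := lvec_gt0 muP d.
have pd1 : lvec p d <= 1.
  rewrite -[lvec p d]mulr1 -lee_fin -(mu_cyl muP d [::]).
  by apply: probability_le1; exact: measurable_cyl.
have := aw; rewrite -(weight_gt0 muP).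
set x := weight P a w; set y := weight P b _; set pa := lvec p a.
set pd := lvec p d in pd1 *; set m := fine _ => x0 pd0 pa0 fy H.
rewrite ltNge; apply/negP => em.
have : e * f / 2 * (pa * x) < e * f * (pa * x).
  by rewrite ltr_pM2r ?mulr_gt0// ltr_pdivrMr// ltr_pMr ?ltr1n// mulr_gt0.
rewrite ltNge => /negP; apply; apply: le_trans H.
have -> : pa * (x * y) / pd * m = m / pd * y * (pa * x) by field; rewrite gt_eqF.
rewrite ler_pM2r ?mulr_gt0//; apply: ler_pM => //; try exact: ltW.
by rewrite ler_pdivlMr// (le_trans _ em)// ger_pMr.
Qed.

Section chaining.
Hypothesis wis : weakly_inverse_symmetric P.
Hypothesis con : forall a b, exists u, path (succ P) a (rcons u b).
Hypothesis colcon : forall a b,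
  connect (fun a b => [exists c, succ P a c && succ P b c]) a b.

Lemma succ_wis a b i j : b != a -> b != linv a ->
  succ P a b -> succ P (lexp a i) (lexp b j).
Proof.
move=> ba bla; rewrite -[succ P a b]negbK -(lmx_eq0 muP) => ab.
by rewrite -[succ _ _ _]negbK -(lmx_eq0 muP); apply: contraNneq ab => /(wis ba bla) ->.
Qed.

(* A path from [linv b] to [b] enters [b] from another letter. *)
Lemma exists_pred b : exists a, [/\ succ P a b, b != a & b != linv a].
Proof.
have [u] := con (linv b) b.
have : linv b != b := linv_neq b.
elim: u (linv b) => [|c u IH] a ab /=.
  rewrite andbT => sab; exists a; split => //; first by rewrite eq_sym.
  exact: (succ_neq muP).
move=> /andP[sac]; have [cb|cb] := eqVneq c b; last exact: IH.
move=> _; exists a; rewrite -cb; split => //.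
- by rewrite cb eq_sym.
- exact: (succ_neq muP).
Qed.

(** Restart the path at its last visit to [T] and remove the loops: the letters after the first are
    then distinct and outside [T]. *)
Lemma exists_short_path (e : rel (letter r)) (T : pred (letter r)) a b :
  connect e a b -> T a -> exists c u,
    [/\ T c, path e c u, last c u = b & (size u + #|T| <= #|{: letter r}|)%N].
Proof.
move=> /connectP[u]; have [n] := ubnP (size u).
elim: n u a => // n IH u a; rewrite ltnS => un au bE Ta.
have [/hasP[c cu Tc]|/hasPn Tu] := boolP (has T u).
  move: un au bE; case/splitPr: cu => u1 u2; rewrite size_cat /= => un.
  rewrite cat_path /= => /and3P[_ _ cu2]; rewrite last_cat /= => bE.
  by apply: IH cu2 bE Tc; apply: leq_trans un; rewrite addnS ltnS leq_addl.
case/shortenP: au bE un => v av uv vu bE _.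
exists a, v; split => //.
have -> : size v = #|v| by apply/esym/card_uniqP; case/andP: uv.
rewrite -(cardC T) addnC leq_add2l; apply: subset_leq_card.
by apply/fintype.subsetP => x xv; rewrite inE; exact: Tu (vu x xv).
Qed.

Lemma exists_letter A : measurable A -> (0 < mu A)%E ->
  exists d, 0 < fine (mu (A `&` cyl hr [:: d])).
Proof.
move=> mA; apply: contraPP => /forallNP H; rewrite (mu_cyl_sum 1 mA) big1 ?ltxx//.
move=> w _; case/tupleP: w => d w; rewrite (tuple0 w) /=.
have mAd := measurableI _ _ mA (measurable_cyl hr [:: d]).
rewrite -(fine_probabilityK mu mAd); congr EFin; apply/eqP.
by rewrite eq_le fine_ge0// andbT leNgt; apply/negP/H.
Qed.

(** [V] misses too little of [D] to avoid the part of [U] inside [D]. *)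
Lemma overlap U V D : measurable U -> measurable V -> measurable D ->
  fine (mu (D `\` V)) < fine (mu (U `&` D)) -> (0 < mu (U `&` V))%E.
Proof.
move=> mU mV mD DV; have mUV := measurableI _ _ mU mV.
rewrite -(fine_probabilityK mu mUV) lte_fin.
have : fine (mu (U `&` D)) <= fine (mu (U `&` V)) + fine (mu (D `\` V)).
  apply: fine_probabilityU => //; [exact: measurableI|exact: measurableD|].
  by move=> x [Ux Dx]; case: (pselect (V x)) => Vx; [left|right].
lra.
Qed.

(** By weak inverse symmetry, [linv a] precedes [b] whenever a predecessor [a] different from [b]
    and its inverse does. *)
Lemma card_pred b : (1 < #|[pred a | succ P a b]|)%N.
Proof.
have [a [ab ba bla]] := exists_pred b; apply/card_gt1P; exists a, (linv a).
rewrite !inE ab (@succ_wis a b true false)// eq_sym; split => //.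
exact: linv_neq.
Qed.

Lemma strictly_irreducible_chaining : chaining mu act (2 * r - 1)%N.
Proof.
move=> A B mA mB A0 B0.
have [d0 Ad0] := exists_letter mA A0; have [d1 Bd1] := exists_letter mB B0.
have [q q0 qP] := pos_lower_bound (lvec_gt0 muP).
(* The bound [q / 2] makes two translates fill more than half of a common [[d]], hence meet; the
   other two bounds make a translate meet [A] inside [[d0]] and [B] inside [[d1]]. *)
pose e := Num.min (q / 2) (Num.min (fine (mu (A `&` cyl hr [:: d0])))
  (fine (mu (B `&` cyl hr [:: d1])))).
have e0 : 0 < e by rewrite !lt_min Ad0 Bd1 divr_gt0.
have /choice[g gP] c := exists_filling c con mA A0 e0.
have mg c : measurable (act (g c) @` A) by exact: measurable_act.
have md d : measurable (cyl hr [:: d]) by exact: measurable_cyl.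
have gg c c' d : succ P c d -> succ P c' d ->
    (0 < mu ((act (g c) @` A) `&` (act (g c') @` A)))%E.
  move=> cd c'd; apply: (overlap (mg c) (mg c') (md d)).
  have Hc := gP c d cd; have Hc' := gP c' d c'd.
  have : fine (mu (cyl hr [:: d])) <= fine (mu (act (g c) @` A `&` cyl hr [:: d]))
      + fine (mu (cyl hr [:: d] `\` act (g c) @` A)).
    apply: fine_probabilityU => //; [exact: measurableI|exact: measurableD|].
    by move=> x dx; case: (pselect ((act (g c) @` A) x)) => gx; [left|right].
  have -> : fine (mu (cyl hr [:: d])) = lvec p d by rewrite (mu_cyl muP) /= mulr1.
  have := qP d; have : e <= q / 2 by rewrite /e ge_min lexx.
  lra.
have [c c0] : exists c, succ P c d0 by have [c []] := exists_pred d0; exists c.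
have [c' c1] : exists c, succ P c d1 by have [c1 []] := exists_pred d1; exists c1.
(* The path may start at any predecessor of [d0]. As there are at least two of them, it has at most
   [2 * r - 1] vertices. *)
have [b [u [b0 bu bE us]]] :=
  exists_short_path (T := [pred a | succ P a d0]) (colcon c c') c0.
have {}us : (size u < 2 * r - 1)%N.
  have := leq_trans (leq_add (leqnn (size u)) (card_pred d0)) us.
  rewrite card_prod card_ord card_bool; lia.
(* The default [c'] of [nth] is the last vertex of the path: a shorter chain is padded to the exact
   length by repeating its last translate. *)
exists (fun i => if i is j.+1 then g (nth c' (b :: u) j) else 1%g); split => //.
- move=> [|i] ik /=.
    rewrite act_image1; last exact: bact_action.
    apply: (overlap mA (mg b) (md d0)); apply: lt_le_trans (gP _ _ b0) _.
    by rewrite !ge_min lexx orbT.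
  have [iu|iu] := ltnP i (size u).
    have /existsP[d /andP[d2 d3]] := pathP c' bu i iu; exact: (gg _ _ _ d2 d3).
  have -> : nth c' u i = c' by rewrite nth_default.
  have -> : nth c' (b :: u) i = c'.
    move: iu; rewrite leq_eqVlt => /predU1P[<-|iu]; last by rewrite nth_default.
    by rewrite -[RHS]bE (last_nth c').
  exact: (gg _ _ _ c1 c1).
- have -> : (2 * r - 1 = (2 * r - 2).+1)%N by move: hr; lia.
  have -> : nth c' (b :: u) (2 * r - 2) = c'.
    have : (size u <= 2 * r - 2)%N by move: us; lia.
    rewrite leq_eqVlt => /predU1P[<-|iu]; last by rewrite nth_default.
    by rewrite -[RHS]bE (last_nth c').
  rewrite setIC; apply: (overlap mB (mg c') (md d1)).
  apply: lt_le_trans (gP _ _ c1) _.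
  by rewrite !ge_min lexx !orbT.
Qed.

End chaining.
End density.

(** * Bounded chaining implies weak mixing *)

Lemma ae_measurable d (T : measurableType d) (R : realType)
    (mu : {measure set T -> \bar R}) (Q : set T) :
  (\forall x \ae mu, Q x) ->
  exists D, [/\ measurable D, mu (~` D) = 0%E & D `<=` Q].
Proof.
move=> [N [mN N0 QN]]; exists (~` N); split; rewrite ?setCK//.
  exact: measurableC.
by move=> x Nx; apply: contrapT => Qx; apply: Nx; exact: QN.
Qed.

Lemma bigcup_null d (T : measurableType d) (R : realType)
    (mu : {measure set T -> \bar R}) (F : (set T)^nat) :
  (forall n, measurable (F n)) -> (forall n, mu (F n) = 0%E) ->
  mu (\bigcup_n F n) = 0%E.
Proof.
move=> mF F0; have [n|N [mN N0 sub]] := @negligible_bigcup _ _ _ mu F.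
  by exists (F n); split; [exact: mF|exact: F0|].
by apply: (subset_measure0 _ mN sub N0); exact: bigcupT_measurable.
Qed.

Section null_sections.
Context d d' (X : measurableType d) (Y : measurableType d') (R : realType).
Variables (mu : probability X R) (nu : probability Y R).
Implicit Types W : set (X * Y).

(** Tonelli: a nonnegative function with zero integral vanishes almost everywhere. *)
Lemma product_null_sections W : measurable W -> (mu \x nu)%E W = 0%E ->
  exists D, [/\ measurable D, mu (~` D) = 0%E &
    forall x, D x -> nu (xsection W x) = 0%E].
Proof.
move=> mW W0; have mf := measurable_fun_xsection nu mW.
have /(ae_eq_integral_abs mu measurableT mf) :
    (\int[mu]_x `|(nu \o xsection W) x|)%E = 0%E.
  rewrite -[RHS]W0; apply: eq_integral => x _; rewrite gee0_abs//.
move=> /ae_measurable[D [mD D0 DW]]; exists D; split => // x /DW.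
exact.
Qed.

Lemma null_sections_product W D : measurable W -> measurable D ->
  mu (~` D) = 0%E -> (forall x, D x -> nu (xsection W x) = 0%E) ->
  (mu \x nu)%E W = 0%E.
Proof.
move=> mW mD D0 DW; have mf := measurable_fun_xsection nu mW.
have : (\int[mu]_x `|(nu \o xsection W) x|)%E = 0%E.
  apply/(ae_eq_integral_abs mu measurableT mf).
  exists (~` D); split => //; first exact: measurableC.
  by move=> x /= H Dx; apply: H => _; rewrite DW.
move=> <-; apply: eq_integral => x _; rewrite gee0_abs//.
Qed.

End null_sections.

Section boundedly_chaining.
Variables (R : realType) (G : groupType) (enum_G : nat -> G).
Hypothesis enum_G_surj : forall g, exists n, enum_G n = g.
Context d d' (X : measurableType d) (Y : measurableType d').
Variables (mu : probability X R) (nu : probability Y R).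
Variables (act : G -> X -> X) (actY : G -> Y -> Y).
Hypotheses (actB : is_borel_action act) (actYB : is_borel_action actY).
Hypothesis actY_mp : measure_preserving nu actY.
Let actP := actB.1.
Let actYP := actYB.1.

Lemma measure_act U g : measurable U -> nu (actY g @` U) = nu U.
Proof. by move=> mU; rewrite (act_imageE actYP) actY_mp. Qed.

Lemma pdist_act g U V : measurable U -> measurable V ->
  pdist nu (actY g @` U) (actY g @` V) = pdist nu U V.
Proof.
move=> mU mV; rewrite /pdist -(measure_act g (measurable_setY mU mV)).
by rewrite !(act_imageE actYP).
Qed.

Lemma pdist_le_bound U V N M : measurable U -> measurable V ->
  measurable N -> measurable M -> nu N = 0%E -> nu M = 0%E ->
  U `+` V `<=` N `|` M -> pdist nu U V = 0.
Proof.
move=> mU mV mN mM N0 M0 sub; apply/eqP; rewrite eq_le pdist_ge0 andbT.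
have := fine_probabilityU nu (measurable_setY mU mV) mN mM sub.
by rewrite N0 M0 addr0.
Qed.

(** The intersection of all translates of [V] is strictly invariant, and by countability of the
    group it differs from [V] by a null set. *)
Lemma ergodic_almost_invariant V : ergodic nu actY -> measurable V ->
  (forall g, pdist nu (actY g @` V) V = 0) -> nu V = 0%E \/ nu (~` V) = 0%E.
Proof.
move=> erg mV VE; pose V' := \bigcap_n (actY (enum_G n) @` V).
have mgV g : measurable (actY g @` V) by exact: borel_act_image.
have mV' : measurable V' by apply: bigcapT_measurable.
have V'P y : V' y <-> forall g, V (actY g y).
  split=> [V'y g|Vy n _].
    have [n ng] := enum_G_surj g^-1%g; have := V'y n Logic.I.
    by rewrite ng (act_imageE actYP)/= invgK.
  by rewrite (act_imageE actYP).
have V'V : V' `<=` V by move=> y /V'P/(_ 1%g); rewrite (act1 actYP).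
have VV' : nu (V `\` V') = 0%E.
  have -> : V `\` V' = \bigcup_n (V `\` actY (enum_G n) @` V).
    by rewrite setDE setC_bigcap setI_bigcupr.
  apply: bigcup_null => n; first exact: measurableD.
  apply: probability_le0; first exact: measurableD.
  by rewrite -(VE (enum_G n)) pdistC pdist_le_diff.
have V'inv g : actY g @` V' = V'.
  rewrite (act_imageE actYP); apply/seteqP; split => y /=.
    move=> /V'P H; apply/V'P => h.
    by have := H (h * g)%g; rewrite (actM actYP) (actKV actYP).
  by move=> /V'P H; apply/V'P => h; rewrite -(actM actYP).
have [|[N [mN N0 sub]]|[N [mN N0 sub]]] := erg V' _ V'inv.
- exists V' => //; exists set0; rewrite ?setU0//; exact: negligible_set0.
- left; apply: probability_le0 => //.
  have VU : V `<=` V' `|` (V `\` V') by rewrite setDUK.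
  have := fine_probabilityU nu mV mV' (measurableD mV mV') VU.
  by rewrite VV' (subset_measure0 mV' mN sub N0) addr0.
- right; apply: (subset_measure0 (measurableC mV) mN _ N0).
  by apply: subset_trans sub => y nVy /V'V.
Qed.


Section ergodicity.
Variables (k : nat) (S : set G).
Hypothesis act_chaining : chaining mu act k.
Hypothesis actY_ergodic : ergodic nu actY.
Hypothesis S_generates : forall K : set G,
  K 1%g -> (forall s g, S s -> K g -> K (s * g)%g) -> forall g, K g.
(** A weak substitute for nonsingularity: a conull set contains some point together with its image
    under [s]. *)
Hypothesis S_recurrent : forall s, S s -> forall D, measurable D ->
  mu (~` D) = 0%E -> exists x, D x /\ D (act s x).

(** Where two translates in the chain meet, equivariance identifies the translated sections, so that
    this link moves the approximating set by at most [2 * e]. There are [k] links between translates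
    of [C] and a last one to [D]. *)
Lemma chaining_pdist (sec : X -> set Y) (C D : set X) (U V : set Y) e :
  (forall x, measurable (sec x)) -> measurable U -> measurable V ->
  (forall g x, C x \/ D x -> C (act g x) \/ D (act g x) ->
     pdist nu (actY g @` sec x) (sec (act g x)) = 0) ->
  measurable C -> measurable D -> (0 < mu C)%E -> (0 < mu D)%E ->
  (forall x, C x -> pdist nu (sec x) U < e) ->
  (forall x, D x -> pdist nu (sec x) V < e) ->
  pdist nu U V <= (2 * k.+1)%:R * e.
Proof.
move=> msec mU mV equiv mC mD C0 D0 CU DV.
have mgY g B : measurable B -> measurable (actY g @` B).
  exact: borel_act_image.
have step g h (E : set X) (W : set Y) : measurable W ->
    (forall x, E x -> C x \/ D x) ->
    (forall x, E x -> pdist nu (sec x) W < e) ->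
    (0 < mu ((act g @` C) `&` (act h @` E)))%E ->
    pdist nu (actY g @` U) (actY h @` W) <= 2 * e.
  move=> mW ECD EW gh0.
  have [x [[a Ca ax] [b Eb bx]]] : (act g @` C) `&` (act h @` E) !=set0.
    by apply/set0P; apply: contraTneq gh0 => ->; rewrite measure0 ltxx.
  have ab : act (h^-1 * g)%g a = b by rewrite (actM actP) ax -bx (actK actP).
  have ab0 : pdist nu (actY g @` sec a) (actY h @` sec b) = 0.
    have := equiv (h^-1 * g)%g a (or_introl Ca); rewrite ab => /(_ (ECD _ Eb)).
    rewrite -(pdist_act h)//; last exact: mgY.
    by rewrite -(act_imageM actYP) mulgA mulgV mul1g.
  apply: le_trans (pdist_triangle nu (mgY g _ mU) (mgY g _ (msec a)) (mgY h _ mW)) _.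
  have := pdist_triangle nu (mgY g _ (msec a)) (mgY h _ (msec b)) (mgY h _ mW).
  rewrite ab0 !pdist_act//; have := CU _ Ca; have := EW _ Eb.
  rewrite [pdist nu U _]pdistC; lra.
have [gam [gam0 gamC gamD]] := act_chaining mC mD C0 D0.
have ind i : (i <= k)%N -> pdist nu U (actY (gam i) @` U) <= (2 * i)%:R * e.
  elim: i => [_|i IH ik]; first by rewrite gam0 (act_image1 actYP) pdistxx mul0r.
  have := pdist_triangle nu mU (mgY (gam i) _ mU) (mgY (gam i.+1) _ mU).
  have := IH (ltnW ik).
  have := step (gam i) (gam i.+1) C U mU (fun x => @or_introl _ _) CU (gamC i ik).
  rewrite mulnS natrD mulrDl; lra.
have := pdist_triangle nu mU (mgY (gam k) _ mU) mV; have := ind k (leqnn k).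
have := step (gam k) 1%g D V mV (fun x => @or_intror _ _) DV.
rewrite (act_image1 actP) (act_image1 actYP) => /(_ gamD).
rewrite mulnS natrD mulrDl; lra.
Qed.

(** At each scale [j], countably many pieces [C j n] cover [good], and [sec] is nearly constant on
    each. Off the null pieces, any two points lie in pieces of positive measure, which
    [chaining_pdist] compares with an error tending to 0. *)
Lemma chaining_sections_ae_constant (sec : X -> set Y) (good : set X) :
  (forall x, measurable (sec x)) ->
  (forall e, 0 < e -> exists2 F : (set Y)^nat, forall n, measurable (F n) &
    forall x, exists n, pdist nu (sec x) (F n) < e) ->
  (forall e V, measurable V -> measurable [set x | pdist nu (sec x) V < e]) ->
  measurable good -> mu (~` good) = 0%E ->
  (forall g x, good x -> good (act g x) ->
     pdist nu (actY g @` sec x) (sec (act g x)) = 0) ->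
  exists V, measurable V /\ exists D : set X, [/\ measurable D, mu (~` D) = 0%E,
    D `<=` good & forall x, D x -> pdist nu (sec x) V = 0].
Proof.
move=> msec sepF msetF mgood good0 equiv.
have /choice[F FP] j : exists F : (set Y)^nat, (forall n, measurable (F n)) /\
    forall x, exists n, pdist nu (sec x) (F n) < j.+1%:R^-1.
  by have [|F mF dF] := sepF j.+1%:R^-1; [rewrite invr_gt0|exists F].
pose C j n := good `&` [set x | pdist nu (sec x) (F j n) < j.+1%:R^-1].
have mC j n : measurable (C j n).
  by apply: measurableI => //; apply: msetF; exact: (FP j).1.
pose N j n := if mu (C j n) == 0%E then C j n else set0.
have mN j n : measurable (N j n) by rewrite /N; case: ifP.
have N0 j n : mu (N j n) = 0%E by rewrite /N; case: ifPn => [/eqP//|_]; rewrite measure0.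
pose M := ~` good `|` \bigcup_j \bigcup_n N j n.
have mNj j : measurable (\bigcup_n N j n) by apply: bigcupT_measurable.
have mM : measurable M.
  by apply: measurableU; [exact: measurableC|exact: bigcupT_measurable].
have M0 : mu M = 0%E.
  have mB : measurable (\bigcup_j \bigcup_n N j n) by exact: bigcupT_measurable.
  rewrite measureU0//; first exact: measurableC.
  by apply: bigcup_null => // j; exact: (bigcup_null (mN j) (N0 j)).
have MC x j n : (~` M) x -> C j n x -> (0 < mu (C j n))%E.
  move=> Mx Cx; rewrite lt0e measure_ge0 andbT; apply/negP => C0; apply: Mx.
  by right; exists j => //; exists n => //; rewrite /N C0.
have Mgood : ~` M `<=` good by move=> x Mx; apply: contrapT => gx; apply: Mx; left.
have main x y : (~` M) x -> (~` M) y -> pdist nu (sec x) (sec y) = 0.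
  move=> Mx My; apply/eqP; rewrite eq_le pdist_ge0 andbT.
  apply/ler_addgt0Pl => e e0; rewrite addr0.
  (* The total error is [2 * k.+1] steps for the chain plus one for each of [x] and [y], that is
     [2 * k.+2] times the scale. *)
  pose j := Num.bound ((2 * k.+2)%:R / e); have [mF dF] := FP j.
  have [n xn] := dF x; have [m ym] := dF y.
  have := @chaining_pdist sec (C j n) (C j m) (F j n) (F j m) j.+1%:R^-1 msec
    (mF n) (mF m).
  have Cgood l z : C j l z -> good z by case.
  move=> /(_ _ (mC j n) (mC j m) _ _ _ _) dnm.
  have {dnm} : pdist nu (F j n) (F j m) <= (2 * k.+1)%:R * j.+1%:R^-1.
    apply: dnm.
    - by move=> g z [/Cgood|/Cgood] gz [/Cgood|/Cgood]; exact: equiv.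
    - exact: MC Mx (conj (Mgood _ Mx) xn).
    - exact: MC My (conj (Mgood _ My) ym).
    - by move=> z [].
    - by move=> z [].
  have := pdist_triangle nu (msec x) (mF n) (msec y).
  have := pdist_triangle nu (mF n) (mF m) (msec y).
  have : (2 * k.+2)%:R * j.+1%:R^-1 <= e.
    rewrite ler_pdivrMr// mulrC -ler_pdivrMr//.
    apply/ltW/(lt_trans (archi_boundP _)); last by rewrite ltr_nat.
    by rewrite divr_ge0// ltW.
  rewrite [pdist nu (F j m) (sec y)]pdistC [(2 * k.+2)%N]mulnS natrD mulrDl.
  move: xn ym; set q := _^-1; lra.
have [x0 Mx0] : ~` M !=set0.
  apply/set0P; apply/eqP => M0'; have : mu setT = 0%E by rewrite -setC0 -M0' setCK.
  by rewrite probability_setT => /eqP; rewrite onee_eq0.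
exists (sec x0); split => //; exists (~` M); split => //.
- exact: measurableC.
- by rewrite setCK.
- by move=> x Mx; exact: main.
Qed.

Lemma chaining_ergodic : ergodic (mu \x nu)%E (diagonal_action act actY).
Proof.
move=> A [W mW [N [N0 [mN0 N00 NN0]] AE]] Ainv.
have AP g x y : A (x, y) <-> A (act g x, actY g y).
  split=> [Axy|]; first by rewrite -(Ainv g); exists (x, y).
  rewrite -{1}(Ainv g) => -[[x' y'] Axy' [xx' yy']].
  by rewrite -(actK actP g x) -(actK actYP g y) -xx' -yy' (actK actP) (actK actYP).
have WA : W `<=` A by rewrite -AE; left.
have AW : A `<=` W `|` N0 by rewrite -AE => z [|/NN0]; [left|right].
(* [A] is invariant but [W] only up to [N0], so equivariance of the sections needs null sections of
   [N0] at both [x] and [act g x]; a singular action may leave [good]. *)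
have [good [mgood good0 goodP]] := product_null_sections mN0 N00.
pose sec x := xsection W x.
have msec x : measurable (sec x) by exact: measurable_xsection.
have mgY g B : measurable B -> measurable (actY g @` B) by exact: borel_act_image.
have equiv g x : good x -> good (act g x) ->
    pdist nu (actY g @` sec x) (sec (act g x)) = 0.
  move=> gx ggx.
  have mNx := measurable_xsection x mN0.
  have mNgx := measurable_xsection (act g x) mN0.
  apply: (pdist_le_bound (mgY g _ (msec x)) (msec _) mNgx (mgY g _ mNx)).
  - exact: goodP.
  - by rewrite measure_act//; exact: goodP.
  - move=> y; rewrite setY_def /= => -[[[z /xsectionP Wz <-] gW]|[/xsectionP Wy gW]].
      have /AW[Wg|] : A (act g x, actY g z) by rewrite -AP; exact: WA.
        by case: gW; apply/xsectionP.
      by move=> N0z; left; apply/xsectionP.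
    right; exists (actY g^-1%g y); rewrite ?(actKV actYP)//.
    have /AW[Wg|//] : A (x, actY g^-1%g y).
        by rewrite (AP g) (actKV actYP); exact: WA.
      by case: gW; exists (actY g^-1%g y); rewrite ?(actKV actYP)//; apply/xsectionP.
    by move=> N0z; apply/xsectionP.
have msetF e V : measurable V -> measurable [set x | pdist nu (sec x) V < e].
  move=> mV; have mWV : measurable (W `+` (setT `*` V)).
    by apply: measurable_setY => //; exact: measurableX.
  have := emeasurable_fun_infty_o measurableT
    (measurable_fun_xsection nu mWV) e%:E.
  have WVE x : xsection (W `+` (setT `*` V)) x = sec x `+` V.
    by rewrite /sec !xsectionE !setY_def; apply/seteqP; split => y /=; tauto.
  rewrite setTI; congr (measurable _); apply/seteqP; split => x /=;
    by rewrite WVE -lte_fin fine_probabilityK//; exact: measurable_setY.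
have [V [mV [D [mD D0 Dgood DV]]]] := chaining_sections_ae_constant msec
  (xsection_separable nu mW) msetF mgood good0 equiv.
(* With [x] and [act s x] both in [D], the sets [s V], [s (sec x)], [sec (s x)] and [V] agree up to
   null sets. *)
have Vinv g : pdist nu (actY g @` V) V = 0.
  move: g; apply: S_generates => [|s g Ss Kg].
    by rewrite (act_image1 actYP) pdistxx.
  have [x [Dx Dsx]] := S_recurrent Ss mD D0.
  apply/eqP; rewrite eq_le pdist_ge0 andbT (act_imageM actYP).
  have := pdist_triangle nu (mgY s _ (mgY g _ mV)) (mgY s _ mV) mV.
  rewrite pdist_act ?Kg ?add0r//; last exact: mgY.
  have := pdist_triangle nu (mgY s _ mV) (mgY s _ (msec x)) mV.
  rewrite pdist_act// [pdist nu V _]pdistC DV// add0r.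
  have := pdist_triangle nu (mgY s _ (msec x)) (msec (act s x)) mV.
  rewrite equiv ?DV// ?addr0; [lra|exact: Dgood|exact: Dgood].
have [V0|V1] := ergodic_almost_invariant actY_ergodic mV Vinv.
- left; exists (W `|` N0); split => //; first exact: measurableU.
  rewrite measureU0//; apply: (null_sections_product mW mD D0) => x Dx.
  apply: probability_le0 => //.
  by have := pdist_le_measure nu (msec x) mV; rewrite DV// addr0 V0.
- right; exists (~` W); split; [exact: measurableC| |exact: subsetC].
  apply: (null_sections_product (measurableC mW) mD D0) => x Dx.
  have mW' := measurable_xsection x (measurableC mW).
  apply: probability_le0 => //.
  have := fine_probabilityU nu mW' (measurableC mV) (measurable_setY (msec x) mV).
  rewrite V1 -/(pdist _ _ _) DV// addr0; apply => y.
  rewrite setY_def => /xsectionP/= nW; have [Vy|Vy] := pselect (V y); [right|by left].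
  by right; split => // /xsectionP.
Qed.

End ergodicity.
End boundedly_chaining.

(** * Weak mixing implies strict irreducibility *)

(** The diagonal is an entourage of the discrete uniformity, so a Cauchy filter contains a set with
    a single point. *)
Lemma nat_cauchy_cvg (F : set_system nat) : ProperFilter F -> cauchy F -> cvg F.
Proof.
move=> FF cF.
have [|[A B] [/= FA FB] AB] := cF [set z | z.1 = z.2].
  by rewrite uniform_discrete => -[x y] [z _ [<- <-]].
have [x Ax] := filter_ex FA.
apply/cvg_ex; exists x => U /nbhs_singleton Ux; apply: filterS FB => y By.
by have /= <- := AB (x, y) (conj Ax By).
Qed.

HB.instance Definition _ := Uniform_isComplete.Build nat nat_cauchy_cvg.

(** The finite test actions below all live on [nat], with a measure carried by finitely many
    labels. *)
Lemma nat_standard_borel (R : realType) : standard_borel R nat.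
Proof.
exists (nat : completePseudoMetricType R), idfun; split.
- exact: discrete_hausdorff.
- exists setT => //; first exact: countableP.
  by move=> U [x Ux] _; exists x.
- by exists idfun.
- by move=> A; split=> // _; apply: sub_sigma_algebra; exact: discrete_open.
Qed.

Lemma countable_bigcup_null d (T : measurableType d) (R : realType)
    (mu : {measure set T -> \bar R}) (U : countType) (D : set U) (F : U -> set T) :
  (forall u, D u -> measurable (F u)) -> (forall u, D u -> mu (F u) = 0%E) ->
  mu (\bigcup_(u in D) F u) = 0%E.
Proof.
move=> mF F0.
pose N n := if unpickle n is Some u then if pselect (D u) then F u else set0
  else set0.
have mN n : measurable (N n).
  by rewrite /N; case: unpickle => // u; case: pselect => //= Du; exact: mF.
have N0 n : mu (N n) = 0%E.
  rewrite /N; case: unpickle => [u|]; last exact: measure0.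
  by case: (pselect (D u)) => /= [Du|_]; [exact: F0|exact: measure0].
have sub : \bigcup_(u in D) F u `<=` \bigcup_n N n.
  move=> x [u Du Fx]; exists (pickle u) => //.
  by rewrite /N pickleK; case: (pselect (D u)).
apply: (subset_measure0 _ _ sub (bigcup_null mN N0)).
  exact: countable_bigcup_measurable.
exact: bigcupT_measurable.
Qed.

(** * Powers of nonnegative matrices and paths *)

Section nonnegative_matrix.
Variables (R : realType) (n : nat) (Q : 'M[R]_n).
Hypothesis Q0 : forall i j, 0 <= Q i j.

Lemma mxpow_ge0 k i j : 0 <= (Q ^+ k) i j.
Proof.
elim: k i j => [|k IH] i j; first by rewrite expr0 mxE; case: eqP.
by rewrite exprS mxE sumr_ge0// => l _; rewrite mulr_ge0.
Qed.

Lemma mxpowS_gt0P k i j : reflect (exists2 l, 0 < Q i l & 0 < (Q ^+ k) l j)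
  (0 < (Q ^+ k.+1) i j).
Proof.
have -> : (0 < (Q ^+ k.+1) i j) = [exists l, (0 < Q i l) && (0 < (Q ^+ k) l j)].
  rewrite exprS mxE lt0r sumr_ge0 ?andbT; last by move=> l _; rewrite mulr_ge0 ?mxpow_ge0.
  rewrite psumr_neq0; last by move=> l _; rewrite mulr_ge0 ?mxpow_ge0.
  apply/hasP/existsP => [[l _ /= H]|[l /andP[l1 l2]]]; exists l;
    rewrite ?mem_index_enum//= ?mulr_gt0//.
  have := mxpow_ge0 k l j; have := Q0 i l; rewrite !le_eqVlt.
  move=> /predU1P[E|->] /predU1P[E'|->] //; move: H;
    by rewrite -?E -?E' ?mul0r ?mulr0 ?ltxx.
by apply: (iffP existsP) => [[l /andP[]]|[l l1 l2]]; exists l => //; rewrite l1.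
Qed.

Lemma mxpow_path i j : (exists2 k, (1 <= k)%N & 0 < (Q ^+ k) i j) <->
  exists u, path (fun a b => 0 < Q a b) i (rcons u j).
Proof.
split=> [[[//|k] _]|[u]].
  elim: k i => [|k IH] i; first by rewrite expr1 => ij; exists [::]; rewrite /= ij.
  by move=> /mxpowS_gt0P[l il /IH[u lu]]; exists (l :: u); rewrite /= il.
elim: u i => [|l u IH] i /=; first by rewrite andbT => ij; exists 1%N.
move=> /andP[il /IH[k k1 lj]]; exists k.+1 => //.
by apply/mxpowS_gt0P; exists l.
Qed.

End nonnegative_matrix.

Lemma irreducible_mxP (R : realType) (T : finType) (Q : 'M[R]_#|T|) :
  (forall i j, 0 <= Q i j) ->
  irreducible_mx Q <-> forall a b : T, exists u,
    path (fun a b => 0 < Q (enum_rank a) (enum_rank b)) a (rcons u b).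
Proof.
move=> Q0; split=> [irr a b|con i j].
  have /(mxpow_path Q0)[u] := irr (enum_rank a) (enum_rank b).
  move=> uP; exists (map enum_val u).
  rewrite -(path_map (f := enum_rank) (e' := fun i j => 0 < Q i j)) map_rcons mapK//.
  exact: enum_valK.
apply/(mxpow_path Q0); have [u] := con (enum_val i) (enum_val j).
rewrite -(path_map (f := enum_rank) (e' := fun i j => 0 < Q i j)) map_rcons !enum_valK.
by exists (map enum_rank u).
Qed.

(** * An invariant set in the product with an action on labels *)

Section product_with_nat.
Context (R : realType) (r : nat) (hr : (0 < r)%N).
Local Notation X := (borel_space (boundary hr)).
Local Notation act := (bact hr).
Variables (P : 'M[R]_#|{: letter r}|) (p : 'rV[R]_#|{: letter r}|).
Variable mu : probability X R.
Hypothesis muP : is_boundary_markov_measure p P mu.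
Implicit Types (a b c d : letter r) (x y : X) (i j m n : nat).

Lemma ae_path : exists N : set X, [/\ measurable N, mu N = 0%E &
  forall x, ~ N x -> forall i, succ P (coord x i) (coord x i.+1)].
Proof.
pose N := \bigcup_(w in [set w | mu (cyl hr w) = 0%E]) cyl hr w.
exists N; split.
- by apply: countable_bigcup_measurable => w _; exact: measurable_cyl.
- by apply: countable_bigcup_null => // w _; exact: measurable_cyl.
- move=> x Nx i.
  have : (0 < mu (cyl hr (mkseq (coord x) i.+2)))%E.
    rewrite lt0e measure_ge0 andbT; apply/negP => /eqP x0; apply: Nx.
    by exists (mkseq (coord x) i.+2) => //; exact: cyl_mkseq.
  rewrite mkseq_cons (mu_cyl_gt0 muP) => /(pathP (coord x 0)) /(_ i).
  rewrite size_mkseq ltnS leqnn -mkseq_cons !nth_mkseq//; exact.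
Qed.

Variable sigma : letter r -> nat -> nat.
Hypothesis sigmaK : forall a, involutive (sigma a).
Hypothesis sigma_linv : forall a, sigma (linv a) = sigma a.

(** Inverse letters need no separate treatment, since [sigma a] is its own inverse and [linv a] acts
    in the same way. *)
Definition nat_action (g : free_group r) (j : nat) : nat := foldr sigma j (fword g).

Lemma nat_action_is_action : is_action nat_action.
Proof.
split=> // g h j; rewrite /nat_action /= /wmul.
elim: (fword g) => //= a u <-; set w := foldr push h u.
by case: w => //= b w; case: eqVneq => [->|//]; rewrite sigma_linv sigmaK.
Qed.

Lemma nat_action_borel : is_borel_action nat_action.
Proof. by split=> [|g _ A _]; [exact: nat_action_is_action|]. Qed.

Variable nu : probability nat R.
Hypothesis nu_sigma : forall a (A : set nat), nu (sigma a @^-1` A) = nu A.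
Hypothesis nu_ergodic : forall A : set nat,
  (forall a j, A j -> A (sigma a j)) -> nu A = 0%E \/ nu (~` A) = 0%E.

Lemma nat_action_preserving : measure_preserving nu nat_action.
Proof.
move=> g A _; move: g A; apply: free_group_ind => // a g IH A.
have -> : nat_action (gen a * g)%g = sigma a \o nat_action g.
  by apply/funext => j; rewrite (actM nat_action_is_action).
by rewrite comp_preimage IH nu_sigma.
Qed.

Lemma nat_action_ergodic : ergodic nu nat_action.
Proof.
move=> A _ Ainv; have [a j Aj|A0|A0] := nu_ergodic (A := A).
- by rewrite -(Ainv (gen a)); exists j.
- by left; exists A; split.
- by right; exists (~` A); split.
Qed.

(* The label reached from [j] along the first [m] letters of [x].  As each
   [sigma a] is an involution, this is the action of (x_0 ... x_(m-1))^-1. *)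
Fixpoint tau (x : X) m j : nat :=
  if m is n.+1 then sigma (coord x n) (tau x n j) else j.

Variable K : letter r -> nat -> Prop.
Hypothesis K_succ : forall a b j, succ P a b -> K a j <-> K b (sigma a j).

(** Asking for all large [m], rather than for [m = 0], makes the set strictly invariant, even at the
    null set of sequences with forbidden transitions. *)
Definition tail_set : set (X * nat) := [set z | exists n, forall m, (n <= m)%N ->
  K (coord z.1 m) (tau z.1 m z.2)].

Lemma measurable_tail_set : measurable tail_set.
Proof.
have -> : tail_set = \bigcup_n \bigcap_(m in [set m | (n <= m)%N])
    \bigcup_j ([set x : X | K (coord x m) (tau x m j)] `*` [set j]).
  apply/seteqP; split => [[x j] [n nP]|[x j] [n _ nP]].
    by exists n => // m nm; exists j => //; split => //; exact: nP.
  by exists n => m /nP[j' _ [/= H ->]].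
apply: bigcupT_measurable => n; apply: bigcap_measurableType => m _.
apply: bigcupT_measurable => j; apply: measurableX => //.
apply: measurable_finite_level; exists m => x y xy.
have E i : (i <= m)%N -> coord x i = coord y i.
  move=> im; have := congr1 (nth (coord x 0) ^~ i) xy.
  by rewrite !nth_mkseq.
rewrite /= E//; suff -> : tau x m j = tau y m j by [].
elim: m E {xy} => //= m IH E; rewrite E// IH// => i im.
by apply: E; exact: leq_trans im _.
Qed.

(** Cancelling or prepending a letter shifts the index by one, and applying [sigma a] to the label
    compensates exactly for that letter in [tau]. *)
Lemma tail_set_gen a z : tail_set z ->
  tail_set (diagonal_action act nat_action (gen a) z).
Proof.
case: z => x j [n /= nP]; rewrite /tail_set /=.
have [x0|x0] := pselect (coord x 0 = linv a).
- have tauE m : tau (act (gen a) x) m (sigma a j) = tau x m.+1 j.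
    elim: m => [|m IH]; first by rewrite /= x0 sigma_linv.
    by rewrite /= IH coord_gen_cancel.
  by exists n => m nm; rewrite tauE coord_gen_cancel//; apply: nP; exact: ltnW.
- have tauE m : tau (act (gen a) x) m.+1 (sigma a j) = tau x m j.
    elim: m => [|m IH]; first by rewrite /= coord_gen_push// sigmaK.
    by rewrite /= -[sigma _ (tau _ m _)]/(tau _ m.+1 _) IH coord_gen_push.
  exists n.+1 => -[//|m] nm; rewrite tauE coord_gen_push//; exact: nP.
Qed.

Lemma tail_set_invariant g :
  diagonal_action act nat_action g @` tail_set = tail_set.
Proof.
have da : is_action (diagonal_action act nat_action).
  split=> [[x j]|h k [x j]]; rewrite /diagonal_action /=.
    by rewrite (act1 (bact_action hr)).
  by rewrite (actM (bact_action hr)) (actM nat_action_is_action).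
have sub h z : tail_set z -> tail_set (diagonal_action act nat_action h z).
  move: h z; apply: free_group_ind => [|a h IH] z Wz; first by rewrite (act1 da).
  by rewrite (actM da); apply: tail_set_gen; exact: IH.
rewrite (act_imageE da); apply/seteqP; split => z; last exact: sub.
by move=> /(sub g); rewrite (actKV da).
Qed.

(* On almost every [x], the relation [K (x_m) (tau x m j)] does not depend on
   [m], so that [(x, j)] is in the invariant set iff [K (x_0) j]. *)
Lemma not_weakly_mixing a b i j : K a i -> (0 < nu [set i])%E ->
  ~ K b j -> (0 < nu [set j])%E -> ~ weakly_mixing mu (boundary_action hr).
Proof.
move=> Kai i0 Kbj j0 wm.
have [N [mN N0 NP]] := ae_path.
have KP x k : ~ N x -> K (coord x 0) k <-> forall m, K (coord x m) (tau x m k).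
  move=> Nx; split=> [Kx|/(_ 0%N)//]; elim=> //= m IH.
  by apply/(K_succ _ (NP x Nx m)).
have nKP x k m : ~ N x -> K (coord x m) (tau x m k) -> K (coord x 0) k.
  by move=> Nx; elim: m => //= m IH /(K_succ _ (NP x Nx m)).
have rect c k : (0 < nu [set k])%E ->
    ((mu \x nu) ((cyl hr [:: c] `\` N) `*` [set k]) != 0)%E.
  move=> k0; have mc := measurable_cyl hr [:: c].
  have mcN := measurableD mc mN; rewrite product_measure1E//.
  rewrite gt_eqF// mule_gt0// lt0e measure_ge0 andbT; apply/eqP => c0.
  have cN : cyl hr [:: c] `<=` (cyl hr [:: c] `\` N) `|` N.
    by move=> x cx; case: (pselect (N x)); [right|left].
  have := fine_probabilityU mu mc (measurableD mc mN) mN cN.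
  rewrite c0 N0 addr0 (mu_cyl muP) /= mulr1 leNgt.
  by rewrite (lvec_gt0 muP).
have mrect c k : measurable (((cyl hr [:: c] `\` N) `*` [set k]) : set (X * nat)).
  apply: measurableX => //; apply: measurableD => //; exact: measurable_cyl.
(* Up to the null set [N], each rectangle [[c] x {k}] thus lies inside or outside [tail_set]. One of
   each kind has positive measure, which contradicts ergodicity. *)
have inW c k x : (cyl hr [:: c] `\` N) x -> tail_set (x, k) <-> K c k.
  move=> [/cylS[<- _] Nx]; split=> [[n /(_ n (leqnn n))]|]; first exact: nKP.
  by move=> /(KP x k Nx) H; exists 0%N => m _; exact: H.
have mT := measurable_tail_set.
have cT : completed_algebra_gen (mu \x nu)%E tail_set.
  by exists tail_set => //; exists set0; rewrite ?setU0//; exact: negligible_set0.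
have [[U [mU U0 sub]]|[U [mU U0 sub]]] := wm _ nat nu nat_action
  (nat_standard_borel R) nat_action_borel nat_action_preserving
  nat_action_ergodic tail_set cT tail_set_invariant.
- have /eqP := rect a i i0; apply; apply: (subset_measure0 (mrect _ _) mU _ U0).
  by move=> [x k] [/= xa ->]; apply: sub; apply/(inW a).
- have /eqP := rect b j j0; apply; apply: (subset_measure0 (mrect _ _) mU _ U0).
  by move=> [x k] [/= xa ->]; apply: sub => /(inW b _ _ xa).
Qed.

End product_with_nat.

(** Conservation of mass: all the mass of [C] stays in [C], so stationarity leaves no room for a
    flow from outside, whereas a transition from [i] to [j] would contribute at least
    [q 0 i * Q i j]. *)
Lemma stationary_closed (R : realType) n (Q : 'M[R]_n) (q : 'rV[R]_n)
    (C : pred 'I_n) : row_stochastic Q -> positive_distribution q ->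
  stationary Q q -> (forall i j, 0 < Q i j -> C i -> C j) ->
  forall i j, 0 < Q i j -> C j -> C i.
Proof.
move=> [Q0 Q1] [q0 _] qQ CC i j ij Cj; apply: contraT => Ci.
have out k : C k -> \sum_(l | C l) Q k l = 1.
  move=> Ck; rewrite -(Q1 k) [RHS](bigID C)/= [X in _ = _ + X]big1 ?addr0// => l Cl.
  by apply/eqP; rewrite eq_le Q0 andbT leNgt; apply: contra Cl => kl; exact: CC Ck.
have : \sum_(l | C l) q 0 l = \sum_k q 0 k * \sum_(l | C l) Q k l.
  under eq_bigr => l _ do rewrite -{1}qQ mxE.
  by rewrite exchange_big; apply: eq_bigr => k _; rewrite mulr_sumr.
rewrite [RHS](bigID C)/= [X in _ = X + _](eq_bigr (fun k => q 0 k)); last first.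
  by move=> k Ck; rewrite out// mulr1.
move=> /eqP; rewrite -[eqbLHS]addr0 (inj_eq (addrI _)) eq_sym; apply: contraLR => _.
rewrite gt_eqF// (bigD1 i)//= ltr_wpDr//.
  by apply: sumr_ge0 => k _; rewrite mulr_ge0 ?(ltW (q0 _))// sumr_ge0.
by rewrite mulr_gt0// (bigD1 j)//= ltr_wpDr// sumr_ge0.
Qed.

(** * The uniform measure on a list of labels *)

Section uniform_measure.
Variables (R : realType) (s : seq nat).

Fact uniform_seq_subproof : 0 <= (size s)%:R^-1 :> R.
Proof. by rewrite invr_ge0. Qed.

(** The proof of non-emptiness is an argument so that the probability structure can be attached to
    the measure. *)
Definition uniform_seq (_ : (0 < size s)%N) : set nat -> \bar R :=
  mscale (NngNum uniform_seq_subproof) (msum (fun i => \d_(nth 0%N s i)) (size s)).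

Variable s0 : (0 < size s)%N.

HB.instance Definition _ := Measure.on (uniform_seq s0).

Lemma uniform_seqE A : uniform_seq s0 A =
  ((size s)%:R^-1 * (count (fun j => `[< A j >]) s)%:R)%:E.
Proof.
rewrite /uniform_seq /mscale EFinM; congr (_ * _)%E; rewrite /= /msum.
transitivity (\sum_(i < size s) (nth 0%N s i \in A)%:R%:E : \bar R)%E.
  by apply: eq_bigr => i _; exact: diracE.
rewrite -(big_mkord xpredT (fun i => (nth 0%N s i \in A)%:R%:E)).
rewrite -(big_nth 0%N xpredT (fun j => (j \in A)%:R%:E)) sumEFin; congr EFin.
rewrite -sum1_count natr_sum [RHS]big_mkcond; apply: eq_bigr => j _ /=.
by case: asboolP => Aj; [rewrite mem_set|rewrite memNset].
Qed.

Let uniform_seqT : uniform_seq s0 setT = 1%E.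
Proof.
rewrite uniform_seqE (eq_count (a2 := predT)) ?count_predT; last first.
  by move=> j; exact/asboolP.
by rewrite mulVf// pnatr_eq0 -lt0n.
Qed.

HB.instance Definition _ :=
  Measure_isProbability.Build _ _ _ (uniform_seq s0) uniform_seqT.

End uniform_measure.

Section weakly_mixing_irreducible.
Variables (R : realType) (r : nat) (hr : (0 < r)%N).
Local Notation X := (borel_space (boundary hr)).
Variables (P : 'M[R]_#|{: letter r}|) (p : 'rV[R]_#|{: letter r}|).
Variable mu : probability X R.
Hypothesis muP : is_boundary_markov_measure p P mu.
Hypothesis wm : weakly_mixing mu (boundary_action hr).
Implicit Types (a b c d : letter r).

Lemma weakly_mixing_irreducible : (exists p' : 'rV[R]_#|{: letter r}|,
    positive_distribution p' /\ stationary P p') ->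
  forall a b, exists u, path (succ P) a (rcons u b).
Proof.
move=> [q [q0 qP]] a b; apply: contrapT => nab.
pose C c := exists u, path (succ P) a (rcons u c).
have CC c d : succ P c d -> C c -> C d.
  move=> cd [u uc]; exists (rcons u c).
  by rewrite rcons_path uc last_rcons.
have CC' c d : succ P c d -> C d -> C c.
  move=> cd Cd; case: muP => Pst _ _.
  have := @stationary_closed _ _ P q (fun i => `[< C (enum_val i) >]) Pst q0 qP.
  move=> /(_ _ (enum_rank c) (enum_rank d) cd); rewrite !enum_rankK => H.
  apply/asboolP/H; last exact/asboolP.
  move=> i j ij /asboolP Ci; apply/asboolP; apply: CC Ci.
  by rewrite /succ /lmx !enum_valK.
(* Paths in [C] have at least one step, so a successor of [a] serves as a letter of [C]. *)
have [a1 aa1] := exists_succ muP a.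
(* The test action is trivial on the single label 0, and [K] depends on the letter alone. *)
apply: (@not_weakly_mixing R r hr P p mu muP (fun _ j => j) _ _ \d_0%N _ _
  (fun c _ => C c) _ a1 b 0%N 0%N _ _ nab _ wm) => //.
- move=> A _; rewrite /= !diracE; case: (pselect (A 0%N)) => A0.
    by right; rewrite memNset//= => /(_ A0).
  by left; rewrite memNset.
- by move=> c d _ cd; split; [exact: CC|exact: CC'].
- by exists [::]; rewrite /= aa1.
- by rewrite /= diracE mem_set.
- by rewrite /= diracE mem_set.
Qed.

Section common_successors.
Hypothesis wis : weakly_inverse_symmetric P.
Hypothesis con : forall a b, exists u, path (succ P) a (rcons u b).
Let e : rel (letter r) := fun a b => [exists c, succ P a c && succ P b c].

(** Classes are coded by natural numbers because they serve as labels in [nat]. *)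
Definition cls a : nat := enum_rank (fingraph.root e a).

Lemma cls_eq a b : (cls a = cls b) <-> connect e a b.
Proof.
have sym : connect_sym e.
  by apply: sym_connect_sym => x y; apply: eq_existsb => z; rewrite andbC.
rewrite -(root_connect sym); split=> [|/eqP]; last by rewrite /cls => ->.
by move=> /val_inj/enum_rank_inj ->.
Qed.

Lemma cls_succ a b c : succ P a c -> succ P b c -> cls a = cls b.
Proof.
by move=> ac bc; apply/cls_eq/connect1/existsP; exists c; rewrite ac.
Qed.

(* A path from [a] to [linv a] leaves [a] for another letter. *)
Lemma exists_succ_neq a : exists b, [/\ succ P a b, b != a & b != linv a].
Proof.
have [u] := con a (linv a); elim: u => [|c u IH] /=.
  by rewrite (succ_linv muP).
move=> /andP[ac]; have [->|ca _] := eqVneq c a; first exact: IH.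
by exists c; split => //; exact: succ_neq muP _ _ ac.
Qed.

(** By weak inverse symmetry, a successor of [a] other than [a] and its inverse also follows
    [linv a]. *)
Lemma cls_linv a : cls (linv a) = cls a.
Proof.
have [b [ab ba bla]] := exists_succ_neq a.
by apply: (cls_succ (c := b)) => //; exact: (succ_wis muP wis true false ba bla).
Qed.

Definition swap (i j k : nat) : nat :=
  if k == i then j else if k == j then i else k.

Lemma swapK i j : involutive (swap i j).
Proof.
move=> k; rewrite /swap; have [->|ki] := eqVneq k i.
  by rewrite eqxx; case: eqP.
by have [->|kj] := eqVneq k j; rewrite ?eqxx// (negPf ki) (negPf kj).
Qed.

Lemma weakly_mixing_common_succ a b : connect e a b.
Proof.
have /choice[pr prP] d : exists c, [/\ succ P c d, d != c & d != linv c].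
  by have := exists_pred muP con d.
(* By [fE] this is the class of every predecessor of [d]. The choice of [pr d] away from [d] and its
   inverse is used for [f_linv]. *)
pose f d := cls (pr d).
have fE c d : succ P c d -> f d = cls c.
  by move=> cd; have [pd _ _] := prP d; exact: cls_succ pd cd.
have f_linv d : f (linv d) = f d.
  have [pd dp dlp] := prP d; apply: fE.
  exact: (succ_wis muP wis false true dp dlp pd).
(* Each class is listed once, so that the transpositions [sigma d] permute [s] and preserve the
   uniform measure. *)
pose s := undup (map cls (enum {: letter r})).
have s_cls c : cls c \in s by rewrite mem_undup map_f// mem_enum.
have s0 : (0 < size s)%N by move: (s_cls a); case: (s).
apply: contrapT => ab.
have {ab} ab : cls a <> cls b by move/cls_eq.
pose sigma d := swap (cls d) (f d).
have s_sigma d j : (sigma d j \in s) = (j \in s).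
  rewrite /sigma /swap; have [->|_] := eqVneq j (cls d); first by rewrite !s_cls.
  by have [->|//] := eqVneq j (f d); rewrite !s_cls.
have perm_sigma d : perm_eq (map (sigma d) s) s.
  apply: uniq_perm; rewrite ?undup_uniq//.
    by rewrite map_inj_uniq ?undup_uniq//; exact: can_inj (swapK _ _).
  move=> j; rewrite -[j in LHS](swapK (cls d) (f d)) mem_map.
    exact: s_sigma.
  exact: can_inj (swapK _ _).
have gt0 j : j \in s -> (0 < uniform_seq R s0 [set j])%E.
  move=> js; rewrite uniform_seqE lte_fin mulr_gt0 ?invr_gt0 ?ltr0n//.
  by rewrite -has_count; apply/hasP; exists j => //; exact/asboolP.
(* Two classes exist, so some label differs from [f a]: the relation [i = f a] holds for one label
   of positive mass and fails for another. *)
have [j js jf] : exists2 j, j \in s & j <> f a.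
  have [fa|] := eqVneq (cls a) (f a); last by move=> /eqP; exists (cls a).
  by exists (cls b) => //; rewrite -fa => /esym.
have fas : f a \in s by exact: s_cls.
apply: (@not_weakly_mixing R r hr P p mu muP sigma _ _ (uniform_seq R s0) _ _
  (fun d i => i = f d) _ a a (f a) j erefl (gt0 _ fas) jf (gt0 _ js) wm).
- by move=> d; exact: swapK.
- by move=> d; rewrite /sigma cls_linv f_linv.
- move=> d A; rewrite /= !uniform_seqE; congr (_ * _%:R)%:E.
  by rewrite -[RHS](permP (perm_sigma d)) count_map.
- move=> A Ainv; have [Aa|nA] := pselect (exists c, A (cls c)); [right|left].
    rewrite /= uniform_seqE (eq_in_count (a2 := pred0)) ?count_pred0 ?mulr0// => x.
    rewrite mem_undup => /mapP[c _ ->]; apply/negbTE/asboolPn; apply.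
    case: Aa => d; have [u] := con d c.
    (* For a transition from [d1] to [d2], the class of [d1] is [f d2], which [sigma d2] exchanges
       with the class of [d2]. Irreducibility then makes the action on labels transitive. *)
    have cl d1 d2 : succ P d1 d2 -> A (cls d1) -> A (cls d2).
      move=> /fE <- /(Ainv d2); rewrite /sigma /swap eqxx.
      by have [->|] := eqVneq (f d2) (cls d2).
    elim: u d => [|d2 u IH] d /=; first by rewrite andbT; exact: cl.
    by move=> /andP[dd2 /IH H] /(cl _ _ dd2).
  rewrite /= uniform_seqE (eq_in_count (a2 := pred0)) ?count_pred0 ?mulr0// => x.
  rewrite mem_undup => /mapP[c _ ->]; apply/negbTE/asboolPn => Ac; apply: nA.
  by exists c.
- move=> c d i cd; rewrite (fE _ _ cd) /sigma /swap.
  split=> [->|]; first by rewrite eqxx; case: eqP.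
  have [->|ic] := eqVneq i (cls c); first by move=> ->.
  by have [->|_ E] := eqVneq i (f c); last by rewrite E eqxx in ic.
Qed.

End common_successors.
End weakly_mixing_irreducible.

(** * The equivalence *)

Section equivalence.
Variables (R : realType) (r : nat) (hr : (0 < r)%N).
Local Notation X := (borel_space (boundary hr)).
Variables (P : 'M[R]_#|{: letter r}|) (p : 'rV[R]_#|{: letter r}|).
Variable mu : probability X R.
Hypothesis muP : is_boundary_markov_measure p P mu.
Implicit Types (a b c d : letter r).

(** For a successor [b] of [a], the letter [a] scales measure on [[b]] by a positive factor, so it
    cannot send almost all of [[b]] into the null complement of [D]. *)
Lemma gen_recurrent a (D : set X) : measurable D -> mu (~` D) = 0%E ->
  exists x, D x /\ D (bact hr (gen a) x).
Proof.
move=> mD D0; have [b ab] := exists_succ muP a.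
have mb := measurable_cyl hr [:: b].
apply: contrapT => /forallNP H.
have mE := measurableI _ _ mb mD.
have mgE := measurable_act (gen a) mE.
have := mu_act_gen muP (succ_neq muP ab) mE (@subIsetl _ _ _).
have gED : bact hr (gen a) @` (cyl hr [:: b] `&` D) `<=` ~` D.
  by move=> _ [x [_ Dx] <-] Dax; exact: (H x).
rewrite (subset_measure0 mgE (measurableC mD) gED D0) => /esym/eqP.
have bE : cyl hr [:: b] `<=` (cyl hr [:: b] `&` D) `|` ~` D.
  by move=> x bx; case: (pselect (D x)); [left|right].
have := fine_probabilityU mu mb mE (measurableC mD) bE.
rewrite D0 addr0 (mu_cyl muP) /= mulr1 => /(lt_le_trans (lvec_gt0 muP b)) E0.
by rewrite gt_eqF// mulr_gt0// divr_gt0 ?(lvec_gt0 muP)// mulr_gt0// (lvec_gt0 muP).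
Qed.

Lemma boundedly_chaining_weakly_mixing :
  boundedly_chaining mu (boundary_action hr) ->
  weakly_mixing mu (boundary_action hr).
Proof.
move=> [k kch] d' Y nu actY _ actYB actYmp actYerg.
have enumP (g : free_group r) :
    exists n, odflt (fone r) (unpickle n : option (free_group r)) = g.
  by exists (pickle g); rewrite pickleK.
have genP (K : set (free_group r)) : K 1%g ->
    (forall s g, range (@gen r) s -> K g -> K (s * g)%g) -> forall g, K g.
  by move=> K1 KM; apply: free_group_ind => // a g; apply: KM; exists a.
have recP s : range (@gen r) s -> forall D, measurable D -> mu (~` D) = 0%E ->
    exists x, D x /\ D (bact hr s x).
  by move=> [a _ <-] D; exact: gen_recurrent.
exact: (chaining_ergodic enumP (bact_borel hr) actYB actYmp kch actYerg genP recP).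
Qed.

Lemma common_succE a b :
  (0 < (P *m P^T) (enum_rank a) (enum_rank b)) =
  [exists c, succ P a c && succ P b c].
Proof.
rewrite mxE (reindex enum_rank)/=; last exact: onW_bij (@enum_rank_bij _).
have P0 c d := lmx_ge0 muP c d.
rewrite lt0r sumr_ge0 ?andbT; last by move=> c _; rewrite mxE mulr_ge0// P0.
rewrite psumr_neq0; last by move=> c _; rewrite mxE mulr_ge0// P0.
apply/hasP/existsP => [[c _ /=]|[c /andP[ac bc]]].
  rewrite mxE -/(lmx P a c) -/(lmx P b c) lt0r mulf_eq0 negb_or !(lmx_eq0 muP) !negbK.
  by move=> /andP[H _]; exists c.
by exists c; rewrite ?mem_index_enum//= mxE mulr_gt0.
Qed.

Lemma strictly_irreducibleP : strictly_irreducible P <->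
  (forall a b, exists u, path (succ P) a (rcons u b)) /\
  (forall a b, connect (fun a b => [exists c, succ P a c && succ P b c]) a b).
Proof.
have P0 i j : 0 <= P i j by case: muP => -[].
have PP0 i j : 0 <= (P *m P^T) i j.
  by rewrite mxE sumr_ge0// => k _; rewrite mxE mulr_ge0.
rewrite /strictly_irreducible !irreducible_mxP//.
split=> -[con concol]; split=> // a b.
  have [u] := concol a b; rewrite (eq_path common_succE) => uP.
  by apply/connectP; exists (rcons u b); rewrite ?last_rcons.
(* [connect] allows the empty path, whereas irreducibility asks for at least one step; a loop at [a]
   is available because [a] shares any successor with itself. *)
have /connectP[u] := concol a b; case/lastP: u => [_ ->|u c uP].
  have [c ac] := exists_succ muP a; exists [::].
  by rewrite (eq_path common_succE) /= andbT; apply/existsP; exists c; rewrite ac.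
rewrite last_rcons => ->; exists u; by rewrite (eq_path common_succE).
Qed.

End equivalence.

Theorem theorem1p2 (R : realType) (r : nat) (hr : (1 <= r)%N)
    (P : 'M[R]_#|{: letter r}|) (p : 'rV[R]_#|{: letter r}|)
    (mu : probability (borel_space (boundary hr)) R)
    (hmu : is_boundary_markov_measure p P mu)
    (hP : weakly_inverse_symmetric P)
    (hstat : exists p' : 'rV[R]_#|{: letter r}|,
       positive_distribution p' /\ stationary P p') :
  [<-> weakly_mixing mu (boundary_action hr);
       boundedly_chaining mu (boundary_action hr);
       chaining mu (boundary_action hr) (2 * r - 1)%N;
       strictly_irreducible P].
Proof.
have h14 : weakly_mixing mu (boundary_action hr) -> strictly_irreducible P.
  move=> wm; apply/(strictly_irreducibleP hmu).
  have con := weakly_mixing_irreducible hmu wm hstat.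
  by split=> // a b; exact: (weakly_mixing_common_succ hmu wm hP con).
have h43 : strictly_irreducible P ->
    chaining mu (boundary_action hr) (2 * r - 1)%N.
  move=> /(strictly_irreducibleP hmu)[con colcon].
  exact: (strictly_irreducible_chaining hmu hP con colcon).
have h32 : chaining mu (boundary_action hr) (2 * r - 1)%N ->
    boundedly_chaining mu (boundary_action hr) by exists (2 * r - 1)%N.
have h21 := boundedly_chaining_weakly_mixing hmu.
tfae => //.
- by move=> /h14/h43/h32.
- by move=> /h21/h14/h43.
- by move=> /h32/h21/h14.
- by move=> /h43/h32/h21.
Qed.
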